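(* For any given $L\ge 0$, $n\ge 2$, $\sigma\ge 0$, and $\tilde\beta\in[\Omega(1),\,1-1/n]$, there exist a set of loss functions $\{f_i\}_{i=1}^n\in\mathcal F_{\Delta,L}$, a set of stochastic gradient oracles in $O_{\sigma^2}$, and a column-stochastic matrix $W\in\mathbb{R}^{n\times n}$ with $\beta_\pi=\tilde\beta$ and $\ln(\kappa_\pi)=\Omega(n(1-\beta_\pi))$, such that the convergence of any algorithm $A\in\mathcal A_W$ starting from $x_i^{(0)}=x^{(0)}$ for all $1\le i\le n$, with $K$ iterations, is lower bounded by $$\mathbb{E}\big[\|\nabla f(\hat x^{(K)})\|_2^2\big]=\Omega\left(\frac{\sigma\sqrt{L\Delta}}{\sqrt{nK}}+\frac{(1+\ln(\kappa_\pi))\,L\Delta}{(1-\beta_\pi)K}\right),\qquad f:=\frac1n\sum_{i=1}^n f_i .$$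
   Context: $\Omega(\cdot)$ hides universal positive constants; $\tilde\beta\in[\Omega(1),1-1/n]$ means that $\tilde\beta$ is at least a universal positive constant and at most $1-1/n$. Mixing matrix. $W=[w_{ij}]\in\mathbb{R}^{n\times n}$ is nonnegative, primitive and column-stochastic, i.e. $\mathbb 1_n^\top W=\mathbb 1_n^\top$, where $\mathbb 1_n$ is the all-ones vector. Its equilibrium vector $\pi\in\mathbb{R}^n$ is the unique vector with positive entries, $W\pi=\pi$ and $\mathbb 1_n^\top\pi=1$. For $A\in\mathbb{R}^{n\times n}$ let $\|A\|_\pi:=\|\mathrm{diag}(\sqrt\pi)^{-1}A\,\mathrm{diag}(\sqrt\pi)\|_2$ (spectral norm; $\sqrt\pi$ entrywise). Define $\beta_\pi:=\|W-\pi\mathbb 1_n^\top\|_\pi\in[0,1)$ (so $1-\beta_\pi$ is the generalized spectral gap) and the equilibrium skewness $\kappa_\pi:=\max_i\pi_i/\min_i\pi_i$. Function class. $\mathcal F_{\Delta,L}$ (with constants $L,\Delta\ge0$) is the set of functions $\{f_i\}_{i=1}^n$, for any underlying dimension $d\ge1$ and initialization $x^{(0)}\in\mathbb{R}^d$, such that $\|\nabla f_i(x)-\nabla f_i(y)\|\le L\|x-y\|$ for all $1\le i\le n$ and $x,y\in\mathbb{R}^d$, and $f=\frac1n\sum_i f_i$ satisfies $f(x^{(0)})-\inf_{x\in\mathbb{R}^d} f(x)\le\Delta$. Oracle class. Node $i$ accesses $f_i$ through a stochastic gradient oracle $\nabla F(x;\xi_i)$ with random $\xi_i$. $O_{\sigma^2}$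 is the set of all oracles with $\mathbb{E}[\nabla F(x;\xi_i)]=\nabla f_i(x)$ and $\mathbb{E}[\|\nabla F(x;\xi_i)-\nabla f_i(x)\|^2]\le\sigma^2$ for all $x\in\mathbb{R}^d$ and $1\le i\le n$. Algorithm class. $\mathcal A_W$ is the set of all decentralized algorithms that follow partial averaging through $W$ and the linear-spanning property: each node $i$ maintains a local solution $x_i^{(k)}$ at iteration $k$; nodes communicate simultaneously via the $W$-protocol, which maps local vectors $z_1,\dots,z_n$ to $z_i^+=\sum_{j=1}^n w_{ij}z_j$ (where $w_{ij}>0$ only if node $j$ sends information to node $i$); and the local solution $x_i^{(k)}$ lies in the linear space spanned by $x_i^{(0)}$, node $i$'s local stochastic gradients, and its interactions with the neighbouring nodes. After $K$ iterations the output $\hat x^{(K)}$ may be any variable in $\mathrm{span}\{x_i^{(k)}:1\le i\le n,\ 0\le k\le K\}$.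
   Formalization: The bound is stated for K ≥ 1 with the displayed rate at most LΔ: otherwise outputting x^(0), where ‖∇f‖² ≤ 2LΔ, refutes it; the functions and oracles may depend on K (W does not), as no single instance works for all K when σ = 0. *)

(* Defs.v *)
(* Decentralized nonconvex stochastic optimization over column-stochastic
   mixing matrices, over an abstract R : realType (MathComp-Analysis). *)
From HB Require Import structures.
From mathcomp Require Import all_boot all_order all_algebra.
From mathcomp Require Import all_classical all_reals all_analysis.
Import Order.TTheory GRing.Theory Num.Theory.
Import numFieldNormedType.Exports.

Set Implicit Arguments.
Unset Strict Implicit.
Unset Printing Implicit Defensive.

Local Open Scope classical_set_scope.
Local Open Scope ring_scope.

(* The coordinate sigma-algebra on matrices, as the library has on tuples; over
   the reals it is the Borel sigma-algebra. *)
Definition matrix_display : measure_display -> measure_display.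
Proof. exact. Qed.

Section measurable_matrix.
Context {d} (T : measurableType d) (m n : nat).

Definition coord_preimages : set (set 'M[T]_(m, n)) :=
  [set C | exists i j,
     preimage_set_system setT (fun A : 'M[T]_(m, n) => A i j) measurable C].

Let matrix_set0 : <<s coord_preimages >> set0.
Proof. exact: sigma_algebra0. Qed.

Let matrix_setC A : <<s coord_preimages >> A -> <<s coord_preimages >> (~` A).
Proof. exact: sigma_algebraC. Qed.

Let matrix_bigcup (F : (set 'M[T]_(m, n))^nat) :
  (forall i, <<s coord_preimages >> (F i)) ->
  <<s coord_preimages >> (\bigcup_i F i).
Proof. exact: sigma_algebra_bigcup. Qed.

HB.instance Definition _ := @isMeasurable.Build (matrix_display d)
  'M[T]_(m, n) <<s coord_preimages >> matrix_set0 matrix_setC matrix_bigcup.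

End measurable_matrix.

Section norms.
Context {R : realType}.

(* The library norm on matrices is the sup norm; on rows and columns this is
   the Euclidean norm. *)
Definition enorm m n (A : 'M[R]_(m, n)) : R :=
  Num.sqrt (\sum_i \sum_j A i j ^+ 2).

Definition spectral_norm n (A : 'M[R]_n) : R :=
  sup [set enorm (A *m v) | v in [set v : 'cV[R]_n | enorm v <= 1]].

Definition pi_norm n (pi : 'cV[R]_n) (A : 'M[R]_n) : R :=
  let D := diag_mx (\row_i Num.sqrt (pi i 0)) in
  spectral_norm (invmx D *m A *m D).

End norms.

Section mixing_matrix.
Context {R : realType} (n : nat).
Implicit Types (W : 'M[R]_n) (pi : 'cV[R]_n).

Definition primitive W := exists2 k, (0 < k)%N & forall i j, 0 < (W ^+ k) i j.

Definition column_stochastic W := const_mx 1 *m W = const_mx 1 :> 'rV[R]_n.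

Definition mixing_matrix W :=
  [/\ forall i j, 0 <= W i j, primitive W & column_stochastic W].

(* For primitive column-stochastic W such a pi is unique (Perron-Frobenius). *)
Definition equilibrium W pi :=
  [/\ forall i, 0 < pi i 0, W *m pi = pi & \sum_i pi i 0 = 1].

Definition beta W pi : R := pi_norm pi (W - pi *m const_mx 1).

(* The default values of the iterated max and min are harmless: entries of an
   equilibrium vector lie in ]0, 1]. *)
Definition kappa pi : R :=
  \big[Num.max/0]_i pi i 0 / \big[Num.min/1]_i pi i 0.

End mixing_matrix.

Section functions_and_oracles.
Context {R : realType} (n d : nat).

Definition gradient (f : 'rV[R]_d -> R) (x : 'rV[R]_d) : 'rV[R]_d :=
  \row_j 'D_(delta_mx 0 j) f x.

Definition average (f : 'I_n -> 'rV[R]_d -> R) (x : 'rV[R]_d) : R :=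
  n%:R^-1 * \sum_i f i x.

(* The infimum is taken in \bar R, so that an average unbounded from below is
   excluded. *)
Definition function_class (Delta L : R) (x0 : 'rV[R]_d)
    (f : 'I_n -> 'rV[R]_d -> R) :=
  [/\ forall i x, differentiable (f i) x,
      forall i x y,
        enorm (gradient (f i) x - gradient (f i) y) <= L * enorm (x - y) &
      ((average f x0)%:E - ereal_inf [set (average f x)%:E | x in setT]
       <= Delta%:E)%E].

(* Node i draws a sample s with law mu i and receives G i x s at x. *)
Definition oracle_class (sigma : R) (f : 'I_n -> 'rV[R]_d -> R)
    {dX} {X : measurableType dX} (mu : 'I_n -> probability X R)
    (G : 'I_n -> 'rV[R]_d -> X -> 'rV[R]_d) :=
  [/\ forall i, measurable_fun setT (fun p : 'rV[R]_d * X => G i p.1 p.2),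
      forall i x j, ('E_(mu i)[fun s => G i x s 0%R j]
                     = (gradient (f i) x 0 j)%:E)%E &
      forall i x,
        ('E_(mu i)[fun s => (enorm (G i x s - gradient (f i) x) ^+ 2)%R]
         <= (sigma ^+ 2)%:E)%E].

End functions_and_oracles.

(* X is measurable with respect to the sigma-algebra F. *)
Definition measurable_wrt {T : Type} {dU} {U : measurableType dU}
    (F : set (set T)) (X : T -> U) :=
  preimage_set_system setT X measurable `<=` F.

Section algorithm.
Context {R : realType} (n d : nat) (W : 'M[R]_n) (x0 : 'rV[R]_d).
Context {dX} {X : measurableType dX} (mu : 'I_n -> probability X R).
Context (G : 'I_n -> 'rV[R]_d -> X -> 'rV[R]_d).

(* The linear space of the vectors node i has access to before iteration k: at
   each iteration it is enlarged by one stochastic gradient, taken at q k i with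
   sample xi k i, and by the vectors sum_j w_ij z_j that the W-protocol returns
   for the b k families z of vectors sent in parallel at that iteration. *)
Fixpoint memory {T : Type} (xi : nat -> 'I_n -> T -> X)
    (q : nat -> 'I_n -> T -> 'rV[R]_d) (b : nat -> nat)
    (z : forall k, 'I_(b k) -> 'I_n -> T -> 'rV[R]_d)
    (k : nat) (i : 'I_n) (w : T) : {vspace 'rV[R]_d} :=
  if k is k'.+1 then
    (memory xi q z k' i w + <[G i (q k' i w) (xi k' i w)]>
     + <<[seq (\sum_j W i j *: z k' l j w)%R | l : 'I_(b k')]>>)%VS
  else <[x0]>%VS.

(* An execution of K iterations, on the probability space (T, P), of an
   algorithm partially averaging through W and having the linear-spanning
   property. The filtration carries the past information, including the internal
   randomness of the algorithm; the choices within the linear spans are otherwise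
   arbitrary, in particular adaptive. *)
Record run (K : nat) {dT} {T : measurableType dT} (P : probability T R) := Run {
  filt : nat -> set (set T) ;
  noise : nat -> 'I_n -> T -> X ;
  query : nat -> 'I_n -> T -> 'rV[R]_d ;
  nmsg : nat -> nat ;
  msg : forall k, 'I_(nmsg k) -> 'I_n -> T -> 'rV[R]_d ;
  sol : nat -> 'I_n -> T -> 'rV[R]_d ;
  output : T -> 'rV[R]_d ;

  filt_sigma : forall k, sigma_algebra setT (filt k) ;
  filt_sub : forall k, filt k `<=` measurable ;
  filt_incr : forall k, filt k `<=` filt k.+1 ;

  noise_adapted : forall k i, (k < K)%N ->
    measurable_wrt (filt k.+1) (noise k i) ;
  query_adapted : forall k i, (k < K)%N ->
    measurable_wrt (filt k) (query k i) ;
  msg_adapted : forall k l i, (k < K)%N ->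
    measurable_wrt (filt k.+1) (@msg k l i) ;
  sol_adapted : forall k i, (k <= K)%N ->
    measurable_wrt (filt k) (sol k i) ;
  output_measurable : measurable_fun setT output ;

  (* the samples of iteration k have laws mu i, and are independent of each
     other and of the past *)
  noise_independent : forall k (A : set T) (B : 'I_n -> set X),
    (k < K)%N -> filt k A -> (forall i, measurable (B i)) ->
    (P (A `&` \bigcap_(i in [set: 'I_n]) (noise k i @^-1` B i))
     = P A * \prod_(i < n) mu i (B i))%E ;

  query_span : forall k i w, (k < K)%N ->
    query k i w \in memory noise query msg k i w ;
  (* what is sent may involve the gradient computed in the same iteration *)
  msg_span : forall k l i w, (k < K)%N ->
    @msg k l i w \in (memory noise query msg k i w
                      + <[G i (query k i w) (noise k i w)]>)%VS ;
  sol_init : forall i w, sol 0 i w = x0 ;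
  sol_span : forall k i w, (k <= K)%N ->
    sol k i w \in memory noise query msg k i w ;
  output_span : forall w,
    output w \in <<[seq sol k i w | k <- iota 0 K.+1, i <- enum 'I_n]>>%VS
}.

End algorithm.

Definition rate {R : realType} (L Delta sigma : R) (n : nat)
    (beta kappa : R) (K : nat) : R :=
  sigma * Num.sqrt (L * Delta) / Num.sqrt (n%:R * K%:R)
  + (1 + ln kappa) * L * Delta / ((1 - beta) * K%:R).

(* Main.v *)
(* A node that only forms linear combinations of what it has seen discovers the
   coordinates of a chain function one at a time, since the gradient vanishes
   beyond the first undiscovered coordinate; as long as the last coordinate is
   undiscovered, the gradient is bounded away from 0. A chain of d coordinates
   fits the class F_{Delta,L} with a squared gradient of order L Delta / d. The
   two terms of the rate come from two ways of making discoveries slow.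
   Noise: all nodes hold the chain and the oracle reveals the new coordinate with
   probability p only, so that n K p discoveries are made on average; p is as
   small as the variance permits.
   Communication: the coordinates are discovered alternately by the first and
   the last third of the nodes, of which W lets information flow from the former
   to the latter one node at a time, so that two discoveries take n / 3 steps.
   For W, a mass moves from node j to node j + 1 with weight r and returns to
   node 0 with weight 1 - r: the equilibrium is geometric of ratio r, and W has
   norm exactly sqrt r (r when n = 2) on the vectors of zero sum. *)
Require Import Defs.
From mathcomp Require Import all_boot all_order all_algebra.
From mathcomp Require Import all_classical all_reals all_analysis.
From mathcomp Require Import measurable_realfun.
From mathcomp Require Import zify ring lra.
Import Order.TTheory GRing.Theory Num.Theory.
Import numFieldNormedType.Exports.

Local Open Scope classical_set_scope.
Local Open Scope ring_scope.

Set Implicit Arguments.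
Unset Strict Implicit.
Unset Printing Implicit Defensive.

(** * Euclidean norm, and spectral norms that are attained *)

Section euclidean_norm.
Context {R : realType}.

Lemma enorm_ge0 m n (A : 'M[R]_(m, n)) : 0 <= enorm A.
Proof. exact: sqrtr_ge0. Qed.

Lemma sqr_enorm m n (A : 'M[R]_(m, n)) :
  enorm A ^+ 2 = \sum_i \sum_j A i j ^+ 2.
Proof.
by rewrite sqr_sqrtr// sumr_ge0// => i _; rewrite sumr_ge0// => j _; exact: sqr_ge0.
Qed.

Lemma sqr_enorm_col n (v : 'cV[R]_n) : enorm v ^+ 2 = \sum_i v i 0 ^+ 2.
Proof. by rewrite sqr_enorm; apply: eq_bigr => i _; rewrite big_ord1. Qed.

Lemma sqr_enorm_row n (v : 'rV[R]_n) : enorm v ^+ 2 = \sum_j v 0 j ^+ 2.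
Proof. by rewrite sqr_enorm big_ord1. Qed.

Lemma spectral_norm_eq n (A : 'M[R]_n) (b : R) (v : 'cV[R]_n) : 0 <= b ->
  (forall u : 'cV[R]_n, enorm (A *m u) <= b * enorm u) ->
  enorm v = 1 -> enorm (A *m v) = b -> spectral_norm A = b.
Proof.
move=> b0 Ab v1 Av.
have ubA : ubound [set enorm (A *m w) | w in [set w : 'cV[R]_n | enorm w <= 1]] b.
  move=> _ [w /= w1 <-]; apply: (le_trans (Ab w)).
  by rewrite -[leRHS]mulr1 ler_wpM2l.
have mem : [set enorm (A *m w) | w in [set w : 'cV[R]_n | enorm w <= 1]] b.
  by exists v => //=; rewrite v1.
apply/eqP; rewrite eq_le; apply/andP; split.
  by apply: ge_sup => //; exists b.
by apply: ub_le_sup => //; exists b.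
Qed.

End euclidean_norm.

(** * The mixing matrix *)

Section renewal_matrix.
Context {R : realType} (n : nat) (r : R).
Hypotheses (r_gt0 : 0 < r) (r_lt1 : r < 1).
Local Notation N := n.+2.

(* Mass moves from j to j + 1 with weight r and is sent back to node 0 with
   weight 1 - r (from the last node, always). *)
Definition renewal_mx : 'M[R]_N :=
  \matrix_(i, j) ((1 - r) * (i == ord0)%:R + r * (i == ordS j)%:R).

Definition geom_total : R := \sum_(k < N) r ^+ k.

Definition geom_dist : 'cV[R]_N := \col_i (r ^+ i / geom_total).

Local Notation W := renewal_mx.
Local Notation pi := geom_dist.

Lemma geom_total_gt0 : 0 < geom_total.
Proof.
rewrite /geom_total big_ord_recl ltr_pwDl ?expr0// sumr_ge0// => i _.
by rewrite exprn_ge0// ltW.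
Qed.

Lemma geom_dist_gt0 i : 0 < pi i 0.
Proof. by rewrite mxE divr_gt0 ?exprn_gt0 ?geom_total_gt0. Qed.

Lemma sum_geom_dist : \sum_i pi i 0 = 1.
Proof.
under eq_bigr do rewrite mxE.
by rewrite -mulr_suml divff// gt_eqF// geom_total_gt0.
Qed.

Lemma geom_total_eq : (1 - r) * geom_total = 1 - r ^+ N.
Proof. by rewrite -[RHS]opprB subrX1 -mulNr opprB. Qed.

Lemma ordS_val (j : 'I_N) : ordS j = (if j == ord_max then 0 else j.+1) :> nat.
Proof.
rewrite /=; case: eqP => [->/=|/eqP jm]; first by rewrite modnn.
by rewrite modn_small// ltnS ltn_neqAle jm /= -ltnS.
Qed.

Lemma geom_dist_ordS j : j != ord_max -> pi (ordS j) 0 = r * pi j 0.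
Proof.
by move=> jm; rewrite !mxE ordS_val (negbTE jm) exprS mulrA.
Qed.

Lemma geom_dist_ord0 : pi ord0 0 = (1 - r) + r * pi ord_max 0.
Proof.
rewrite !mxE expr0 mulrA -exprS.
have Z0 : geom_total != 0 by rewrite gt_eqF// geom_total_gt0.
apply: (mulIf Z0); rewrite mulrDl geom_total_eq !divfK//; ring.
Qed.

(** [W] is [r] times the cyclic shift plus a rank-one matrix that sees only the sum of [u]; on
    vectors of zero sum it is [r] times a permutation. *)
Lemma mul_renewal_mx (u : 'cV[R]_N) i :
  (W *m u) i 0 = (1 - r) * (i == ord0)%:R * (\sum_j u j 0) + r * u (ord_pred i) 0.
Proof.
rewrite mxE; under eq_bigr do rewrite mxE mulrDl.
rewrite big_split /= -mulr_sumr; congr (_ + _).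
rewrite (bigD1 (ord_pred i)) //= ord_predK eqxx mulr1 big1 ?addr0// => j jN.
case: eqP => [ij|]; last by rewrite mulr0 mul0r.
by move: jN; rewrite ij ordSK eqxx.
Qed.

Lemma renewal_mx_equilibrium : equilibrium W pi.
Proof.
split; [exact: geom_dist_gt0| |exact: sum_geom_dist].
apply/colP => i; rewrite mul_renewal_mx sum_geom_dist mulr1.
case: (eqVneq i ord0) => [->|i0].
  rewrite mulr1 geom_dist_ord0; congr (_ + _ * pi _ _).
  by apply/val_inj; rewrite /= modn_small.
have pm : ord_pred i != ord_max.
  apply: contra i0 => /eqP h; rewrite -(ord_predK i) h.
  by apply/eqP/val_inj; rewrite /= modnn.
by rewrite mulr0 add0r -geom_dist_ordS// ord_predK.
Qed.

Lemma renewal_mx_ge0 i j : 0 <= W i j.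
Proof.
by rewrite mxE addr_ge0// mulr_ge0// ?subr_ge0 1?ltW// ler0n.
Qed.

Lemma renewal_mx_neq0 i j : W i j != 0 -> i = 0%N :> nat \/ i = j.+1 :> nat.
Proof.
rewrite mxE; case: (eqVneq i ord0) => [->|i0]; first by left.
case: (eqVneq i (ordS j)) => [ij|]; last by rewrite !mulr0 addr0 eqxx.
move=> _; right; move: i0; rewrite ij ordS_val; case: ifPn => // /eqP ->.
by move=> /negP[]; apply/eqP/val_inj; rewrite /= modnn.
Qed.

Lemma renewal_mx_stochastic : column_stochastic W.
Proof.
apply/rowP => j; rewrite mxE [RHS]mxE.
under eq_bigr do rewrite !mxE mul1r.
rewrite big_split /= (bigD1 ord0)//= [X in _ + X](bigD1 (ordS j))//= !eqxx.
rewrite !big1 ?addr0 ?mulr1; first by rewrite subrK.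
  by move=> i /negbTE ->; rewrite mulr0.
by move=> i /negbTE ->; rewrite mulr0.
Qed.

Lemma renewal_mx_primitive : primitive W.
Proof.
exists n.+2 => //.
(* Mass starting anywhere can return to node 0, wait there, then climb to [i] one node at a time. *)
suff H k (i j : 'I_N) : (i <= k)%N -> 0 < (W ^+ k.+1) i j.
  by move=> i j; apply: H; rewrite -ltnS ltn_ord.
elim: k i j => [|k IH] i j ik.
  rewrite expr1 mxE; have -> : i = ord0 by apply/val_inj/eqP; rewrite /= -leqn0.
  by rewrite eqxx mulr1 ltr_pwDl ?subr_gt0// mulr_ge0// ltW.
have nn (l : 'I_N) : 0 <= W i l * (W ^+ k.+1) l j.
  rewrite mulr_ge0 ?renewal_mx_ge0//.
  elim: (k.+1) l j => [|m IHm] l j'; first by rewrite expr0 mxE; case: eqP.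
  rewrite exprS mxE sumr_ge0// => l' _.
  by rewrite mulr_ge0 ?renewal_mx_ge0.
rewrite exprS mxE.
suff [l Hl] : exists l : 'I_N, 0 < W i l /\ (l <= k)%N.
  case: Hl => Wil lk; rewrite (bigD1 l)//= ltr_pwDl ?mulr_gt0 ?IH//.
  by rewrite sumr_ge0.
case: (eqVneq i ord0) => [->|i0].
  exists ord0; split => //; rewrite mxE eqxx mulr1 ltr_pwDl ?subr_gt0//.
  by rewrite mulr_ge0// ltW.
have ip : (0 < i)%N by rewrite lt0n; apply: contra i0 => /eqP h; apply/eqP/val_inj.
exists (ord_pred i); split; last first.
  rewrite /= -[X in (X %% _)%N](_ : i.-1 + N = _)%N; last by case: (i : nat) ip.
  rewrite modnDr modn_small; first by case: (i : nat) ik.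
  by apply: leq_ltn_trans (ltn_ord i); exact: leq_pred.
by rewrite mxE (negbTE i0) mulr0 add0r ord_predK eqxx mulr1.
Qed.

Lemma renewal_mx_mixing : mixing_matrix W.
Proof.
split; [exact: renewal_mx_ge0|exact: renewal_mx_primitive|].
exact: renewal_mx_stochastic.
Qed.

Local Notation sq := (\row_i Num.sqrt (pi i 0)).
Local Notation B := (invmx (diag_mx sq) *m (W - pi *m const_mx 1) *m diag_mx sq).

Lemma sqrt_geom_dist_gt0 i : 0 < Num.sqrt (pi i 0).
Proof. by rewrite sqrtr_gt0 geom_dist_gt0. Qed.

Lemma invmx_sqrt_geom_dist :
  invmx (diag_mx sq) = diag_mx (\row_i (Num.sqrt (pi i 0))^-1).
Proof.
have E : diag_mx (\row_i (Num.sqrt (pi i 0))^-1) *m diag_mx sq = 1%:M.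
  apply/matrixP => i j; rewrite mul_diag_mx !mxE.
  case: eqP => [->|]; last by rewrite mulr0n mulr0.
  by rewrite mulr1n mulVf// gt_eqF// sqrtr_gt0 divr_gt0 ?exprn_gt0 ?geom_total_gt0.
have [_ U] := mulmx1_unit E.
by rewrite -[RHS]mulmx1 -(mulmxV U) mulmxA E mul1mx.
Qed.

(** The vector [D v], with [D = diag(sqrt pi)], projected along [pi] onto the vectors of zero
    sum. *)
Definition centered (v : 'cV[R]_N) j : R :=
  Num.sqrt (pi j 0) * v j 0 - pi j 0 * \sum_k Num.sqrt (pi k 0) * v k 0.

(** Since [W pi = pi], the matrix [W - pi 1^T] centers its argument and then applies [W], which is
    now a shift scaled by [r]; the entry moved to [ordS j] is divided by the root of its weight
    there. *)
Lemma sqr_enorm_renewal (v : 'cV[R]_N) :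
  enorm (B *m v) ^+ 2 = r ^+ 2 * \sum_j centered v j ^+ 2 / pi (ordS j) 0.
Proof.
rewrite sqr_enorm_col (reindex_inj (@ordS_inj _)) mulr_sumr; apply: eq_bigr => j _.
rewrite invmx_sqrt_geom_dist -!mulmxA mul_diag_mx mxE mulmxBl !mxE.
set u := diag_mx sq *m v.
have uE k : u k 0 = Num.sqrt (pi k 0) * v k 0 by rewrite /u mul_diag_mx !mxE.
have -> : \sum_k W (ordS j) k * u k 0 = (W *m u) (ordS j) 0 by rewrite mxE.
have -> : \sum_k (pi *m const_mx 1) (ordS j) k * u k 0 = pi (ordS j) 0 * \sum_k u k 0.
  by rewrite mulr_sumr; apply: eq_bigr => k _; rewrite mxE big_ord1 [const_mx _ _ _]mxE mulr1.
rewrite mul_renewal_mx ordSK.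
have -> : pi (ordS j) 0 * \sum_k u k 0 =
    ((1 - r) * (ordS j == ord0)%:R + r * pi j 0) * \sum_k u k 0.
  congr (_ * _).
  have [_ /colP/(_ (ordS j)) + _] := renewal_mx_equilibrium.
  by rewrite mul_renewal_mx sum_geom_dist mulr1 ordSK => <-.
rewrite /centered; under [\sum_k Num.sqrt _ * _]eq_bigr do rewrite -uE.
rewrite -uE; set s := \sum_k u k 0.
rewrite exprMn exprVn sqr_sqrtr; last by rewrite ltW// divr_gt0 ?exprn_gt0 ?geom_total_gt0.
move: (_ / geom_total)^-1 (_ == _)%:R => q e; ring.
Qed.

(** In weighted coordinates centering removes the component along the unit vector [sqrt pi]; the two
    sides differ by the square of that component. *)
Lemma sum_sqr_centered (v : 'cV[R]_N) :
  \sum_j centered v j ^+ 2 / pi j 0 <= enorm v ^+ 2.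
Proof.
rewrite sqr_enorm_col.
set s := \sum_k Num.sqrt (pi k 0) * v k 0.
have E j : centered v j ^+ 2 / pi j 0 =
    v j 0 ^+ 2 - 2 * s * (Num.sqrt (pi j 0) * v j 0) + s ^+ 2 * pi j 0.
  rewrite /centered -/s.
  have p0 := geom_dist_gt0 j.
  have := sqr_sqrtr (ltW p0); have := sqrt_geom_dist_gt0 j.
  set q := Num.sqrt _; set p := pi j 0 in p0 *; move=> q0 qE.
  rewrite -qE; field; exact: lt0r_neq0.
under eq_bigr do rewrite E.
rewrite big_split/= sumrB -!mulr_sumr sum_geom_dist -/s.
rewrite -subr_ge0; have := sqr_ge0 s; lra.
Qed.

End renewal_matrix.

(** * The contraction factor and a vector attaining it *)

Section renewal_matrix_gap.
Context {R : realType} (n : nat) (r : R).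
Hypotheses (r_gt0 : 0 < r) (r_lt1 : r < 1).
Local Notation N := n.+2.
Local Notation pi := (@geom_dist R n r).

Lemma sum_centered (v : 'cV[R]_N) : \sum_j centered r v j = 0.
Proof.
rewrite sumrB -mulr_suml sum_geom_dist// mul1r.
by rewrite subrr.
Qed.

(* In unweighted coordinates this is e_0 - e_1, which has zero sum and avoids the
   last node (when n > 2); it attains the norm. *)
Definition extremal_vector : 'cV[R]_N :=
  \col_i ((i == ord0)%:R / Num.sqrt (pi ord0 0)
          - (i == lift ord0 ord0)%:R / Num.sqrt (pi (lift ord0 ord0) 0)).

Lemma centered_extremal j : centered r extremal_vector j =
  (j == ord0)%:R - (j == lift ord0 ord0)%:R.
Proof.
have E k : Num.sqrt (pi k 0) * extremal_vector k 0 =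
    (k == ord0)%:R - (k == lift ord0 ord0)%:R.
  rewrite [extremal_vector k 0]mxE mulrBr; congr (_ - _).
    case: eqP => [->|]; last by rewrite !mul0r mulr0.
    by rewrite mul1r mulfV// gt_eqF// sqrt_geom_dist_gt0.
  case: eqP => [->|]; last by rewrite !mul0r mulr0.
  by rewrite mul1r mulfV// gt_eqF// sqrt_geom_dist_gt0.
rewrite /centered E; under eq_bigr do rewrite E.
rewrite sumrB (bigD1 ord0)//= big1 ?addr0; last by move=> i /negbTE ->.
rewrite (bigD1 (lift ord0 ord0))//= big1 ?addr0; last by move=> i /negbTE ->.
by rewrite subrr mulr0 subr0.
Qed.

Lemma sqr_enorm_extremal :
  enorm extremal_vector ^+ 2 = (pi ord0 0)^-1 + (pi (lift ord0 ord0) 0)^-1.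
Proof.
rewrite sqr_enorm_col !big_ord_recl big1 ?addr0; last first.
  by move=> i _; rewrite mxE /= !mul0r subr0 expr0n.
rewrite 2![extremal_vector _ _]mxE !eqxx.
have -> : (ord0 == lift ord0 ord0 :> 'I_N) = false by [].
have -> : (lift ord0 ord0 == ord0 :> 'I_N) = false by [].
rewrite !mul0r !mul1r subr0 sub0r sqrrN !exprVn.
by rewrite !sqr_sqrtr// ltW// geom_dist_gt0.
Qed.

(** It suffices that [r / pi (ordS j) <= 1 / pi j]: an equality along the path, where the weight
    drops by [r], and an inequality at the wrap from the last node to node 0. *)
Lemma le_sqr_enorm_renewal (v : 'cV[R]_N) (D := diag_mx (\row_i Num.sqrt (pi i 0))) :
  enorm (invmx D *m (renewal_mx n r - pi *m const_mx 1) *m D *m v) ^+ 2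
  <= r * enorm v ^+ 2.
Proof.
rewrite sqr_enorm_renewal// expr2 -mulrA ler_wpM2l ?(ltW r_gt0)//.
apply: le_trans (sum_sqr_centered r_gt0 v); rewrite mulr_sumr.
apply: ler_sum => j _; rewrite mulrCA ler_wpM2l ?sqr_ge0//.
have p0 := @geom_dist_gt0 _ n _ r_gt0.
case: (eqVneq j ord_max) => [->|jm]; last first.
  by rewrite geom_dist_ordS// invfM mulrA mulfV ?mul1r// gt_eqF.
have -> : ordS ord_max = ord0 :> 'I_N by apply/val_inj; rewrite /= modnn.
rewrite ler_pdivrMr// mulrC ler_pdivlMr// geom_dist_ord0//.
have : r * pi ord_max 0 <= pi ord_max 0 by rewrite ler_piMl// ltW.
have : r * pi ord_max 0 <= pi ord0 0.
  by rewrite geom_dist_ord0// lerDr subr_ge0 ltW.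
by rewrite geom_dist_ord0//; lra.
Qed.

End renewal_matrix_gap.

(** * Exact spectral gap and skewness *)

Section renewal_matrix_beta.
Context {R : realType}.

Lemma normalized_extremal n (r : R) (A : 'M[R]_n.+2) (b : R) :
  0 < r -> 0 <= b ->
  enorm (A *m extremal_vector n r) ^+ 2 = b ^+ 2 * enorm (extremal_vector n r) ^+ 2 ->
  exists2 v : 'cV[R]_n.+2, enorm v = 1 & enorm (A *m v) = b.
Proof.
move=> r0 b0 H; set e := extremal_vector n r in H *.
have e0 : 0 < enorm e.
  rewrite lt0r enorm_ge0 andbT -sqrf_eq0 sqr_enorm_extremal//.
  by rewrite gt_eqF// addr_gt0// invr_gt0 geom_dist_gt0.
have Z (m : nat) (u : 'cV[R]_m) : enorm ((enorm e)^-1 *: u) = (enorm e)^-1 * enorm u.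
  apply/eqP; rewrite -(@eqrXn2 _ 2)// ?enorm_ge0 ?mulr_ge0 ?invr_ge0 ?enorm_ge0//.
  rewrite exprMn !sqr_enorm_col mulr_sumr; apply/eqP; apply: eq_bigr => i _.
  by rewrite mxE exprMn.
exists ((enorm e)^-1 *: e); first by rewrite Z mulVf// gt_eqF.
rewrite -scalemxAr Z.
suff -> : enorm (A *m e) = b * enorm e by rewrite mulrCA mulVf ?mulr1// gt_eqF.
apply/eqP; rewrite -(@eqrXn2 _ 2)// ?enorm_ge0 ?mulr_ge0 ?enorm_ge0//.
by rewrite exprMn H.
Qed.

(** With at least three nodes, the successors of 0 and 1 are both lighter by the factor [r], so the
    extremal vector attains the bound [sqrt r]. *)
Lemma renewal_beta_big n (r b : R) : 0 < b -> b < 1 -> r = b ^+ 2 ->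
  beta (renewal_mx n.+1 r) (geom_dist n.+1 r) = b.
Proof.
move=> b0 b1 rb.
have r0 : 0 < r by rewrite rb exprn_gt0.
have r1 : r < 1 by rewrite rb exprn_ilt1// ltW.
rewrite /beta /pi_norm.
set A := invmx _ *m _ *m _.
have [v v1 Av] : exists2 v : 'cV[R]_n.+3, enorm v = 1 & enorm (A *m v) = b.
  apply: (normalized_extremal r0 (ltW b0)).
  rewrite sqr_enorm_renewal// sqr_enorm_extremal// 2!big_ord_recl big1 ?addr0; last first.
    by move=> i _; rewrite centered_extremal// /= subr0 expr0n mul0r.
  rewrite !centered_extremal// !eqxx.
  have -> : (ord0 == lift ord0 ord0 :> 'I_n.+3) = false by [].
  have -> : (lift ord0 ord0 == ord0 :> 'I_n.+3) = false by [].
  rewrite subr0 sub0r sqrrN expr1n !geom_dist_ordS// -rb !invfM.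
  have := @geom_dist_gt0 _ n.+1 _ r0 ord0; have := @geom_dist_gt0 _ n.+1 _ r0 (lift ord0 ord0).
  set p := geom_dist _ _ _ _; set q := geom_dist _ _ _ _ => p0 q0.
  by field; rewrite !gt_eqF.
apply: (spectral_norm_eq (ltW b0) _ v1 Av) => u.
rewrite -ler_sqr ?nnegrE ?mulr_ge0 ?enorm_ge0 ?(ltW b0)//.
by rewrite exprMn -rb; exact: le_sqr_enorm_renewal.
Qed.

(** With two nodes the centered entries are opposite, so swapping them does not change their squares
    and the norm is the factor [r] of the shift. *)
Lemma renewal_beta_two (r : R) : 0 < r -> r < 1 ->
  beta (renewal_mx 0 r) (geom_dist 0 r) = r.
Proof.
move=> r0 r1; rewrite /beta /pi_norm.
set A := invmx _ *m _ *m _.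
have p0 := @geom_dist_gt0 _ 0 _ r0.
have S0 : ordS ord0 = lift ord0 ord0 :> 'I_2 by exact/val_inj.
have S1 : ordS (lift ord0 ord0) = ord0 :> 'I_2 by exact/val_inj.
have E u : enorm (A *m u) ^+ 2 = r ^+ 2 * \sum_j centered r u j ^+ 2 / geom_dist 0 r j 0.
  rewrite sqr_enorm_renewal//; congr (_ * _).
  have := sum_centered r0 u; rewrite !big_ord_recl !big_ord0 !addr0 S0 S1.
  by move/eqP; rewrite addrC addr_eq0 => /eqP ->; rewrite sqrrN addrC.
have [v v1 Av] : exists2 v : 'cV[R]_2, enorm v = 1 & enorm (A *m v) = r.
  apply: (normalized_extremal r0 (ltW r0)); rewrite E sqr_enorm_extremal//.
  rewrite !big_ord_recl big_ord0 !centered_extremal// !eqxx.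
  have -> : (ord0 == lift ord0 ord0 :> 'I_2) = false by [].
  have -> : (lift ord0 ord0 == ord0 :> 'I_2) = false by [].
  by rewrite subr0 sub0r sqrrN expr1n !mul1r addr0.
apply: (spectral_norm_eq (ltW r0) _ v1 Av) => u.
rewrite -ler_sqr ?nnegrE ?mulr_ge0 ?enorm_ge0 ?(ltW r0)//.
by rewrite exprMn E ler_wpM2l ?sqr_ge0// sum_sqr_centered.
Qed.

Lemma kappa_geom_dist n (r : R) : 0 < r -> r < 1 ->
  kappa (geom_dist n r) = r ^- n.+1.
Proof.
move=> r0 r1; rewrite /kappa.
have Z0 := @geom_total_gt0 _ n _ r0.
have p0 := @geom_dist_gt0 _ n _ r0.
have le1 i : geom_dist n r i 0 <= 1.
  rewrite -(@sum_geom_dist _ n _ r0) (bigD1 i)//= lerDl sumr_ge0// => j _.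
  exact: ltW.
have mono (i j : 'I_n.+2) : (i <= j)%N -> geom_dist n r j 0 <= geom_dist n r i 0.
  move=> ij; rewrite !mxE ler_pM2r ?invr_gt0//.
  by apply: ler_wiXn2l => //; exact: ltW.
have -> : \big[Num.max/0]_i geom_dist n r i 0 = geom_dist n r ord0 0.
  apply/eqP; rewrite eq_le; apply/andP; split.
    by apply: bigmax_le => [|i _]; [exact: ltW|exact: mono].
  exact: (le_bigmax 0 (fun i => geom_dist n r i 0) ord0).
have -> : \big[Num.min/1]_i geom_dist n r i 0 = geom_dist n r ord_max 0.
  apply/eqP; rewrite eq_le; apply/andP; split.
    exact: (bigmin_le 1 ord_max (fun i => geom_dist n r i 0)).
  by apply: le_bigmin => // i _; apply: mono; rewrite /= -ltnS.
rewrite !mxE expr0 invfM invrK mul1r mulrCA mulVf ?mulr1//.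
exact: lt0r_neq0.
Qed.

Lemma ln_kappa_geom_dist n (r : R) : 0 < r -> r < 1 ->
  ln (kappa (geom_dist n r)) = n.+1%:R * - ln r.
Proof.
move=> r0 r1; rewrite kappa_geom_dist// lnV ?posrE ?exprn_gt0// lnXn//.
by rewrite -mulNrn mulr_natl.
Qed.

(** This is [ln x <= x - 1] at [b] and at its inverse. *)
Lemma ln_bounds (b : R) : 0 < b -> b <= 1 -> 1 - b <= - ln b <= (1 - b) / b.
Proof.
have ln_le x : 0 < x -> ln x <= x - 1 :> R.
  move=> x0; have := @le_ln1Dx _ (x - 1).
  by rewrite (_ : 1 + (x - 1) = x); [apply; lra|ring].
move=> b0 b1; apply/andP; split; first by have := ln_le _ b0; lra.
rewrite -lnV ?posrE//; apply: le_trans (ln_le _ _) _; first by rewrite invr_gt0.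
by rewrite mulrBl mul1r mulfV// gt_eqF.
Qed.

(** The ratio [r] is [b] for two nodes and [b ^ 2] otherwise, and [ln kappa = (n - 1) (- ln r)]. The
    upper bound on [ln kappa] serves to compare the rate with [n / K]; the last clause lists the
    edges available to information. *)
Lemma mixing_matrix_exists (n : nat) (b : R) : (2 <= n)%N -> 0 < b -> b < 1 ->
  exists (W : 'M[R]_n) (pi : 'cV[R]_n),
    [/\ mixing_matrix W, equilibrium W pi, beta W pi = b,
        2^-1 * (n%:R * (1 - b)) <= ln (kappa pi) <= 2 * n%:R * ((1 - b) / b) &
        forall i j, W i j != 0 -> i = 0%N :> nat \/ i = j.+1 :> nat].
Proof.
case: n => [|[|[|n]]]// _ b0 b1.
- exists (renewal_mx 0 b), (geom_dist 0 b); split.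
  + exact: renewal_mx_mixing.
  + exact: renewal_mx_equilibrium.
  + exact: renewal_beta_two.
  + have /andP[] := ln_bounds b0 (ltW b1).
    have : 0 <= (1 - b) / b by rewrite divr_ge0// ?subr_ge0 ltW.
    by rewrite ln_kappa_geom_dist// mul1r => *; apply/andP; split; lra.
  + exact: renewal_mx_neq0.
- have r0 : 0 < b ^+ 2 by rewrite exprn_gt0.
  have r1 : b ^+ 2 < 1 by rewrite exprn_ilt1// ltW.
  exists (renewal_mx n.+1 (b ^+ 2)), (geom_dist n.+1 (b ^+ 2)); split.
  + exact: renewal_mx_mixing.
  + exact: renewal_mx_equilibrium.
  + exact: renewal_beta_big.
  + have /andP[l u] := ln_bounds b0 (ltW b1).
    rewrite ln_kappa_geom_dist// lnXn// -mulNrn -[(- ln b) *+ 2]mulr_natl.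
    rewrite -(natr1 n.+2) -(natr1 n.+1).
    have n0 : 0 <= n.+1%:R :> R by rewrite ler0n.
    have b10 : 0 < 1 - b by rewrite subr_gt0.
    move: l u n0 b10; set x := - ln b; set y := (1 - b) / b; set m := n.+1%:R.
    move=> l u n0 b10; apply/andP; split; nra.
  + exact: renewal_mx_neq0.
Qed.

End renewal_matrix_beta.

(** * The chain function *)

Section hinge_functions.
Context {R : realType}.
Implicit Types x y h : R.

Definition hinge x : R := Num.max x 0.
Definition sqhinge x : R := hinge x ^+ 2 / 2.
(** [tent] is the triangle of height 1 on [0, 2] and [ramp] its antiderivative, a C^1 step from 0 to
    1. *)
Definition tent x : R := hinge x - 2 * hinge (x - 1) + hinge (x - 2).
Definition ramp x : R := sqhinge x - 2 * sqhinge (x - 1) + sqhinge (x - 2).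

Lemma hinge_id x : 0 <= x -> hinge x = x.
Proof. by move=> x0; exact/max_idPl. Qed.

Lemma hinge_eq0 x : x <= 0 -> hinge x = 0.
Proof. by move=> x0; exact/max_idPr. Qed.

Lemma hinge_lipschitz x y : `|hinge x - hinge y| <= `|x - y|.
Proof.
rewrite /hinge; case: (leP x 0) => x0; case: (leP y 0) => y0.
- by rewrite subrr normr0.
- by rewrite sub0r normrN gtr0_norm// ltr0_norm; lra.
- by rewrite subr0 gtr0_norm// gtr0_norm; lra.
- by [].
Qed.

Lemma tent_piecewise x : [\/ x <= 0 /\ tent x = 0, 0 <= x <= 1 /\ tent x = x,
  1 <= x <= 2 /\ tent x = 2 - x | 2 <= x /\ tent x = 0].
Proof.
rewrite /tent; have [x0|x0] := leP x 0.
  by apply: Or41; rewrite !hinge_eq0; lra.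
have [x1|x1] := leP x 1.
  by apply: Or42; rewrite hinge_id ?(ltW x0)// !hinge_eq0; lra.
have [x2|x2] := leP x 2.
  by apply: Or43; rewrite (@hinge_id x) ?(@hinge_id (x - 1)) ?hinge_eq0; lra.
by apply: Or44; rewrite !hinge_id; lra.
Qed.

Lemma ramp_piecewise x : [\/ x <= 0 /\ ramp x = 0, 0 <= x <= 1 /\ ramp x = x ^+ 2 / 2,
  1 <= x <= 2 /\ ramp x = 1 - (2 - x) ^+ 2 / 2 | 2 <= x /\ ramp x = 1].
Proof.
rewrite /ramp /sqhinge; have [x0|x0] := leP x 0.
  by apply: Or41; rewrite !hinge_eq0; lra.
have [x1|x1] := leP x 1.
  by apply: Or42; rewrite (@hinge_id x) ?(ltW x0)// !hinge_eq0; lra.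
have [x2|x2] := leP x 2.
  by apply: Or43; rewrite (@hinge_id x) ?(@hinge_id (x - 1)) ?hinge_eq0; lra.
by apply: Or44; rewrite !hinge_id; lra.
Qed.

Lemma tent_bounds x : 0 <= tent x <= 1.
Proof. by apply/andP; case: (tent_piecewise x) => -[? ->]; split; lra. Qed.

Lemma ramp_bounds x : 0 <= ramp x <= 1.
Proof. by apply/andP; case: (ramp_piecewise x) => -[? ->]; split; nra. Qed.

Lemma tent_lipschitz x y : `|tent x - tent y| <= `|x - y|.
Proof.
wlog xy : x y / x <= y => [W|].
  by have [/W//|/ltW/W] := leP x y; rewrite distrC [`|y - x|]distrC.
rewrite (distrC x) (ger0_norm (_ : 0 <= y - x)) ?subr_ge0// ler_norml.
by apply/andP; case: (tent_piecewise x) => -[? ->];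
  case: (tent_piecewise y) => -[? ->]; split; lra.
Qed.

Lemma ramp_nondecreasing x y : x <= y -> ramp x <= ramp y.
Proof.
by move=> xy; case: (ramp_piecewise x) => -[? ->];
  case: (ramp_piecewise y) => -[? ->]; nra.
Qed.

Lemma ramp_lipschitz x y : `|ramp x - ramp y| <= `|x - y|.
Proof.
wlog xy : x y / x <= y => [W|].
  by have [/W//|/ltW/W] := leP x y; rewrite distrC [`|y - x|]distrC.
rewrite (distrC x) (ger0_norm (_ : 0 <= y - x)) ?subr_ge0// (distrC (ramp x)).
rewrite ger0_norm ?subr_ge0 ?ramp_nondecreasing//.
by case: (ramp_piecewise x) => -[? ->]; case: (ramp_piecewise y) => -[? ->]; nra.
Qed.

(** [sqhinge] is convex and its derivative [hinge] is 1-Lipschitz. *)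
Lemma sqhinge_taylor x h : 0 <= sqhinge (x + h) - sqhinge x - hinge x * h <= h ^+ 2 / 2.
Proof.
rewrite /sqhinge; apply/andP.
have [x0|x0] := leP 0 x; [rewrite (hinge_id x0)|rewrite (hinge_eq0 (ltW x0))];
 (have [xh0|xh0] := leP 0 (x + h); [rewrite (hinge_id xh0)|rewrite (hinge_eq0 (ltW xh0))]);
 split; nra.
Qed.

(** The allowance [h ^ 2] fits [ramp], whose three [sqhinge] remainders lie in [0, h^2/2] and have
    coefficients 1, -2, 1. *)
Lemma is_diff_quadratic (F : R -> R) x (g : R) :
  (forall h, `|F (x + h) - F x - g * h| <= h ^+ 2) -> is_diff x F (fun h => g * h).
Proof.
move=> H; have [dF DF] : is_derive x 1 F g.
  have C : h^-1 *: (F (h *: (1 : R) + x) - F x) @[h --> 0^'] --> g.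
    apply/cvgrPdist_le => /= e e0; near=> h.
    have h0 : h != 0 by near: h; exact: nbhs_dnbhs_neq.
    have he : `|h| <= e.
      near: h; apply: nbhs_dnbhs; apply/nbhs_ballP; exists e => //= z.
      by rewrite /ball /= sub0r normrN => /ltW.
    rewrite -[_ *: (1 : R)]/(h * 1) mulr1 [h + x]addrC -[_ *: _]/(h^-1 * _).
    have -> : g - h^-1 * (F (x + h) - F x) = - (h^-1 * (F (x + h) - F x - g * h)).
      by field.
    rewrite normrN normrM normfV ler_pdivrMl ?normr_gt0//.
    apply: (le_trans (H h)); rewrite -real_normK ?num_real// expr2.
    by rewrite ler_wpM2l.
  by apply: DeriveDef; [apply/cvg_ex; exists g|exact/cvg_lim].
apply: DiffDef; first exact/derivable1_diffP.
by rewrite deriv1E//; apply/funext => h /=; rewrite derive1E DF mulrC.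
Unshelve. all: by end_near. Qed.

Lemma is_diff_ramp x : is_diff x ramp (fun h => tent x * h).
Proof.
apply: is_diff_quadratic => h.
have := sqhinge_taylor x h; have := sqhinge_taylor (x - 1) h.
have := sqhinge_taylor (x - 2) h; rewrite /ramp /tent ![x - _ + h]addrAC.
by move=> /andP[? ?] /andP[? ?] /andP[? ?]; rewrite ler_norml; apply/andP; split; nra.
Qed.

Lemma is_diff_ramp_shift x : is_diff x (fun y => ramp (y + 1)) (fun h => tent (x + 1) * h).
Proof.
apply: is_diff_quadratic => h.
have := sqhinge_taylor (x + 1) h; have := sqhinge_taylor (x + 1 - 1) h.
have := sqhinge_taylor (x + 1 - 2) h; rewrite /ramp /tent.
rewrite ![x + 1 - _ + h]addrAC ![x + 1 + h]addrAC.
by move=> /andP[? ?] /andP[? ?] /andP[? ?]; rewrite ler_norml; apply/andP; split; nra.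
Qed.

Lemma is_diff_sqhinge_opp x :
  is_diff x (fun y => sqhinge (- y)) (fun h => - hinge (- x) * h).
Proof.
apply: is_diff_quadratic => h.
have := sqhinge_taylor (- x) (- h); rewrite -opprD sqrrN.
by move=> /andP[? ?]; rewrite ler_norml; apply/andP; split; nra.
Qed.

End hinge_functions.

(** * Gradient and smoothness of the chain *)

Section chain.
Context {R : realType} (d : nat) (wt : nat -> R) (alpha lam : R).
Implicit Types (x v : 'rV[R]_d) (t : nat) (a b : R).

(* Coordinates are shifted by one and rescaled; the value 2 in front of them
   makes the first link active, and the value -1 behind them kills the link
   leaving the last one. *)
Definition coordz x t : R :=
  if t is t'.+1 then (if insub t' is Some j then x 0 j / lam else -1) else 2.

(** The linear part of the affine map [coordz]: its differential, and its increment between two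
    points. *)
Definition dcoordz v t : R :=
  if t is t'.+1 then (if insub t' is Some j then v 0 j / lam else 0) else 0.

Arguments coordz : simpl never.
Arguments dcoordz : simpl never.

(* The ramp of a switches on the push of b upwards through [0, 1/2]; for negative
   b, where the ramp of b + 1 becomes flat, the squared hinge takes over. *)
Definition link a b : R := sqhinge (- b) - ramp a * ramp (b + 1).
(** [link1] and [link2] are the partial derivatives of [link] in [a] and in [b]. *)
Definition link1 a b : R := - (tent a * ramp (b + 1)).
Definition link2 a b : R := - hinge (- b) - ramp a * tent (b + 1).

Definition chain x : R :=
  alpha * \sum_(t < d) wt t * link (coordz x t) (coordz x t.+1).

(** Coordinate [j] is the target of link [j] and the source of link [j.+1]; for the last coordinate
    the second term is 0. *)
Definition chain_grad x (j : 'I_d) : R := alpha / lam *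
  (wt j * link2 (coordz x j) (coordz x j.+1)
   + wt j.+1 * link1 (coordz x j.+1) (coordz x j.+2)).

Lemma coordzS x (j : 'I_d) : coordz x j.+1 = x 0 j / lam.
Proof. by rewrite /coordz valK. Qed.

Lemma dcoordzS v (j : 'I_d) : dcoordz v j.+1 = v 0 j / lam.
Proof. by rewrite /dcoordz valK. Qed.

Lemma coordz_out x : coordz x d.+1 = -1.
Proof. by rewrite /coordz insubF// ltnn. Qed.

Lemma coordzB x y t : coordz x t - coordz y t = dcoordz (x - y) t.
Proof.
case: t => [|t]; first by rewrite subrr.
by rewrite /coordz /dcoordz; case: insubP => [j _ _|_]; rewrite ?subrr// !mxE -mulrBl.
Qed.

Lemma dcoordz_delta (j : 'I_d) t : dcoordz (delta_mx 0 j) t = (t == j.+1)%:R / lam.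
Proof.
case: t => [|t]; first by rewrite mul0r.
rewrite /dcoordz; case: insubP => [k _ <-|tj]; first by rewrite mxE eqxx /= eqSS.
by rewrite eqSS; case: eqP tj => [->|_ _]; rewrite ?ltn_ord// mul0r.
Qed.

Lemma is_diff_coordz x t : is_diff x (coordz ^~ t) (dcoordz ^~ t).
Proof.
case: t => [|t]; first exact: (is_diff_cst (2 : R^o) x).
rewrite /coordz /dcoordz; case: insubP => [j _ _|_]; last exact: (is_diff_cst (-1 : R^o) x).
have dc := differentiable_coord x 0 j.
have E : 'd (fun y : 'rV[R]_d => y 0 j : R) x = (fun v => v 0 j) :> (_ -> _).
  have @f : {linear 'rV[R]_d -> R}.
    by exists (fun N : 'rV[R]_d => N 0 j); do 2![eexists]; do ?[constructor];
       rewrite ?mxE// => ? *; rewrite ?mxE//; move=> ?; rewrite !mxE.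
  by rewrite (diff_lin _ (f := f))//; exact: coord_continuous.
have H := is_diffZ lam^-1 (@differentiableP _ _ _ _ _ dc).
rewrite (_ : (fun y => _) = lam^-1 *: (fun y : 'rV[R]_d => y 0 j)); last first.
  by apply/funext => y /=; rewrite mulrC.
by rewrite E in H.
Qed.

Lemma is_diff_link x t : is_diff x (fun y => link (coordz y t) (coordz y t.+1))
  (fun v => link2 (coordz x t) (coordz x t.+1) * dcoordz v t.+1
            + link1 (coordz x t) (coordz x t.+1) * dcoordz v t).
Proof.
have c0 := is_diff_coordz x t; have c1 := is_diff_coordz x t.+1.
have r0 := @is_diff_comp _ _ _ _ _ _ _ _ _ c0 (is_diff_ramp (coordz x t)).
have r1 := @is_diff_comp _ _ _ _ _ _ _ _ _ c1 (is_diff_ramp_shift (coordz x t.+1)).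
have s1 := @is_diff_comp _ _ _ _ _ _ _ _ _ c1 (is_diff_sqhinge_opp (coordz x t.+1)).
have H := is_diffB s1 (is_diffM r0 r1).
refine (is_diff_eq H _).
apply/funext => v; rewrite /link1 /link2 /=; set a := coordz x t; set b := coordz x t.+1.
rewrite -[RHS]/(_ + _) -[LHS]/(- hinge (- b) * dcoordz v t.+1 -
  (ramp a * (tent (b + 1) * dcoordz v t.+1) + ramp (b + 1) * (tent a * dcoordz v t))).
ring.
Qed.

Lemma is_diff_sumn (V : normedModType R) (z : V) m (F dF : nat -> V -> R) :
  (forall t, is_diff z (F t) (dF t)) ->
  is_diff z (fun y => \sum_(t < m) F t y) (fun v : V => \sum_(t < m) dF t v).
Proof.
move=> H; elim: m => [|m IH].
  rewrite (_ : (fun y => _) = cst 0); last by apply/funext => y; rewrite big_ord0.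
  rewrite [X in is_diff _ _ X](_ : _ = 0); last by apply/funext => y; rewrite big_ord0.
  exact: is_diff_cst.
rewrite (_ : (fun y => _) = (fun y => \sum_(t < m) F t y) + F m); last first.
  by apply/funext => y; rewrite big_ord_recr.
rewrite [X in is_diff _ _ X](_ : _ = (fun y => \sum_(t < m) dF t y) + dF m); last first.
  by apply/funext => y; rewrite big_ord_recr.
exact: is_diffD.
Qed.

Lemma is_diff_chain x : is_diff x chain (fun v => alpha * \sum_(t < d) wt t *
  (link2 (coordz x t) (coordz x t.+1) * dcoordz v t.+1
   + link1 (coordz x t) (coordz x t.+1) * dcoordz v t)).
Proof.
have S := @is_diff_sumn _ x d _ _ (fun t => is_diffZ (wt t) (is_diff_link x t)).
exact: (is_diffZ alpha S).
Qed.

Lemma differentiable_chain x : differentiable chain x.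
Proof. by have [] := is_diff_chain x. Qed.

Lemma tent0 : tent 0 = 0 :> R.
Proof. by case: (tent_piecewise (0 : R)) => -[? ->]; lra. Qed.

Lemma ramp0 : ramp 0 = 0 :> R.
Proof. by case: (ramp_piecewise (0 : R)) => -[? ->]; nra. Qed.

Lemma gradient_chain x : gradient chain x = \row_j chain_grad x j.
Proof.
apply/rowP => j; rewrite !mxE deriveE; last exact: differentiable_chain.
have [_ ->] := is_diff_chain x.
under eq_bigr do rewrite !dcoordz_delta mulrDr.
rewrite big_split /= (bigD1 j)//= eqxx big1 ?addr0; last first.
  by move=> t tj; rewrite eqSS -val_eqE in tj *; rewrite (negbTE tj) mul0r !mulr0.
have -> : \sum_(t < d) wt t * (link1 (coordz x t) (coordz x t.+1) * ((t == j.+1 :> nat)%:R / lam))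
    = wt j.+1 * link1 (coordz x j.+1) (coordz x j.+2) / lam.
  have [jd|jd] := ltnP j.+1 d.
    rewrite (bigD1 (Ordinal jd))//= eqxx big1 ?addr0; first by rewrite div1r mulrA.
    by move=> t; rewrite -val_eqE /= => /negbTE ->; rewrite mul0r !mulr0.
  rewrite big1 => [|t _].
    have -> : j.+2 = d.+1 by have := ltn_ord j; lia.
    by rewrite coordz_out /link1 addNr ramp0 mulr0 oppr0 mulr0 mul0r.
  by rewrite (_ : (t == j.+1 :> nat) = false) ?mul0r ?mulr0//;
    apply/eqP => E; move: (ltn_ord t); rewrite E ltnNge jd.
by rewrite /chain_grad mulr1n; ring.
Qed.

Lemma link1_lipschitz a b a' b' :
  `|link1 a b - link1 a' b'| <= `|a - a'| + `|b - b'|.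
Proof.
rewrite /link1 opprK addrC.
have -> : tent a' * ramp (b' + 1) - tent a * ramp (b + 1) =
  (tent a' - tent a) * ramp (b' + 1) + tent a * (ramp (b' + 1) - ramp (b + 1)) by ring.
apply: (le_trans (ler_normD _ _)); rewrite !normrM; apply: lerD.
  rewrite -[leRHS]mulr1 distrC ler_pM//; first exact: tent_lipschitz.
  by have /andP[? ?] := ramp_bounds (b' + 1); rewrite ger0_norm.
rewrite -[leRHS]mul1r ler_pM//.
  by have /andP[? ?] := tent_bounds a; rewrite ger0_norm.
rewrite distrC; apply: (le_trans (ramp_lipschitz _ _)).
by rewrite opprD addrACA subrr addr0.
Qed.

Lemma link2_lipschitz a b a' b' :
  `|link2 a b - link2 a' b'| <= `|a - a'| + 2 * `|b - b'|.
Proof.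
rewrite /link2.
have -> : - hinge (- b) - ramp a * tent (b + 1) - (- hinge (- b') - ramp a' * tent (b' + 1)) =
  (hinge (- b') - hinge (- b)) +
  ((ramp a' - ramp a) * tent (b' + 1) + ramp a * (tent (b' + 1) - tent (b + 1))) by ring.
have h1 : `|hinge (- b') - hinge (- b)| <= `|b - b'|.
  by apply: (le_trans (hinge_lipschitz _ _)); rewrite opprK addrC.
have h2 : `|(ramp a' - ramp a) * tent (b' + 1)| <= `|a - a'|.
  rewrite normrM -[leRHS]mulr1 distrC ler_pM//; first exact: ramp_lipschitz.
  by have /andP[? ?] := tent_bounds (b' + 1); rewrite ger0_norm.
have h3 : `|ramp a * (tent (b' + 1) - tent (b + 1))| <= `|b - b'|.
  rewrite normrM -[leRHS]mul1r ler_pM//.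
    by have /andP[? ?] := ramp_bounds a; rewrite ger0_norm.
  rewrite distrC; apply: (le_trans (tent_lipschitz _ _)).
  by rewrite opprD addrACA subrr addr0.
apply: (le_trans (ler_normD _ _)); apply: (le_trans (lerD h1 (ler_normD _ _))).
lra.
Qed.

Hypotheses (alpha_ge0 : 0 <= alpha) (lam_gt0 : 0 < lam).

(** An entry involves three consecutive coordinates: [link2] contributes [p + 2 q] and [link1]
    contributes [q + r]. The factor 5 is Cauchy-Schwarz with weights 1, 3, 1. *)
Lemma chain_grad_lipschitz w x y (j : 'I_d) :
  (forall t, 0 <= wt t <= w) ->
  (chain_grad x j - chain_grad y j) ^+ 2 <= (alpha / lam * w) ^+ 2 *
    (5 * (dcoordz (x - y) j ^+ 2 + 3 * dcoordz (x - y) j.+1 ^+ 2 + dcoordz (x - y) j.+2 ^+ 2)).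
Proof.
move=> wtw; rewrite /chain_grad -mulrBr exprMn [(alpha / lam * w) ^+ 2]exprMn -[leRHS]mulrA.
rewrite ler_wpM2l ?sqr_ge0//.
have w0 : 0 <= w by have /andP[] := wtw 0%N; exact: le_trans.
have := link2_lipschitz (coordz x j) (coordz x j.+1) (coordz y j) (coordz y j.+1).
have := link1_lipschitz (coordz x j.+1) (coordz x j.+2) (coordz y j.+1) (coordz y j.+2).
rewrite !coordzB.
set p := dcoordz _ j; set q := dcoordz _ j.+1; set r := dcoordz _ j.+2.
set A := link1 _ _; set A' := link1 _ _; set B := link2 _ _; set B' := link2 _ _.
move=> hA hB.
have -> : wt j * B + wt j.+1 * A - (wt j * B' + wt j.+1 * A')
  = wt j * (B - B') + wt j.+1 * (A - A') by ring.
have H : `|wt j * (B - B') + wt j.+1 * (A - A')| <= w * (`|p| + 3 * `|q| + `|r|).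
  apply: (le_trans (ler_normD _ _)); rewrite !normrM.
  have /andP[j0 jw] := wtw j; have /andP[j10 j1w] := wtw j.+1.
  rewrite (ger0_norm j0) (ger0_norm j10).
  have h1 : wt j * `|B - B'| <= w * (`|p| + 2 * `|q|) by rewrite ler_pM.
  have h2 : wt j.+1 * `|A - A'| <= w * (`|q| + `|r|) by rewrite ler_pM.
  by apply: (le_trans (lerD h1 h2)); rewrite -mulrDr ler_wpM2l//; lra.
rewrite -real_normK ?num_real//.
apply: (@le_trans _ _ ((w * (`|p| + 3 * `|q| + `|r|)) ^+ 2)).
  by rewrite ler_sqr ?nnegrE// mulr_ge0// !addr_ge0// mulr_ge0.
rewrite exprMn ler_wpM2l ?sqr_ge0//.
rewrite -(real_normK (num_real p)) -(real_normK (num_real q)) -(real_normK (num_real r)).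
by have := sqr_ge0 (`|p| - `|q|); have := sqr_ge0 (`|p| - `|r|);
  have := sqr_ge0 (`|q| - `|r|); nra.
Qed.

Lemma sum_dcoordzS v : \sum_(j < d) dcoordz v j.+1 ^+ 2 = enorm v ^+ 2 / lam ^+ 2.
Proof.
rewrite sqr_enorm_row mulr_suml; apply: eq_bigr => j _.
by rewrite dcoordzS expr_div_n.
Qed.

Lemma sum_dcoordz_le v : \sum_(j < d) dcoordz v j ^+ 2 <= \sum_(j < d) dcoordz v j.+1 ^+ 2.
Proof.
have := @big_ord_recl R 0 +%R d (fun j : 'I_d.+1 => dcoordz v j ^+ 2).
rewrite big_ord_recr /= expr0n add0r.
under [X in _ = X -> _]eq_bigr do rewrite /bump /= add1n.
by move=> <-; rewrite lerDl sqr_ge0.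
Qed.

Lemma sum_dcoordzSS_le v :
  \sum_(j < d) dcoordz v j.+2 ^+ 2 <= \sum_(j < d) dcoordz v j.+1 ^+ 2.
Proof.
have := @big_ord_recl R 0 +%R d (fun j : 'I_d.+1 => dcoordz v j.+1 ^+ 2).
rewrite big_ord_recr /=.
under [X in _ = _ + X -> _]eq_bigr do rewrite /bump /= add1n.
by rewrite {2}/dcoordz insubF ?ltnn// expr0n /= addr0 => ->; rewrite lerDr sqr_ge0.
Qed.

(** Each shifted sum of squares is at most the full one, so the total is 5 (1 + 3 + 1) = 25 times
    it, whence the 5 in the hypothesis. *)
Lemma gradient_chain_lipschitz (w L : R) x y : (forall t, 0 <= wt t <= w) ->
  0 <= L -> 5 * w * alpha <= L * lam ^+ 2 ->
  enorm (gradient chain x - gradient chain y) <= L * enorm (x - y).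
Proof.
move=> wtw L0 HL.
have w0 : 0 <= w by have /andP[] := wtw 0%N; exact: le_trans.
rewrite -ler_sqr ?nnegrE ?mulr_ge0 ?enorm_ge0//.
rewrite sqr_enorm_row.
under eq_bigr do rewrite !gradient_chain !mxE.
apply: (@le_trans _ _ (\sum_(j < d) (alpha / lam * w) ^+ 2 *
    (5 * (dcoordz (x - y) j ^+ 2 + 3 * dcoordz (x - y) j.+1 ^+ 2 + dcoordz (x - y) j.+2 ^+ 2)))).
  by apply: ler_sum => j _; exact: chain_grad_lipschitz.
rewrite -mulr_sumr -mulr_sumr !big_split /= -mulr_sumr.
have := sum_dcoordz_le (x - y); have := sum_dcoordzSS_le (x - y).
have := sum_dcoordzS (x - y).
set S := \sum_(j < d) dcoordz _ j.+1 ^+ 2; move=> SE h1 h2.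
apply: (@le_trans _ _ ((alpha / lam * w) ^+ 2 * (25 * S))).
  by rewrite ler_wpM2l ?sqr_ge0//; lra.
rewrite SE [leRHS]exprMn.
have -> : (alpha / lam * w) ^+ 2 * (25 * (enorm (x - y) ^+ 2 / lam ^+ 2)) =
   (5 * w * alpha / lam ^+ 2) ^+ 2 * enorm (x - y) ^+ 2.
  by field; rewrite gt_eqF.
rewrite ler_wpM2r ?sqr_ge0// ler_sqr ?nnegrE//.
  by rewrite ler_pdivrMr// exprn_gt0.
by rewrite divr_ge0 ?sqr_ge0// !mulr_ge0.
Qed.

End chain.

(** * Discovery, large gradients and bounded depth of the chain *)

Section chain_landscape.
Context {R : realType} (d : nat) (alpha lam : R).
Hypotheses (alpha_ge0 : 0 <= alpha) (lam_gt0 : 0 < lam).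
Implicit Types (x : 'rV[R]_d) (a b : R) (wt : nat -> R).

Lemma coordz_eq0 x m t : (forall j : 'I_d, (m <= j)%N -> x 0 j = 0) ->
  (m < t <= d)%N -> coordz lam x t = 0.
Proof.
move=> xm; case: t => [|t] /andP[]//; rewrite ltnS => mt td.
by rewrite (coordzS lam x (Ordinal td)) xm ?mul0r.
Qed.

Lemma link1_0 b : link1 0 b = 0 :> R.
Proof. by rewrite /link1 tent0 mul0r oppr0. Qed.

Lemma link2_0 a : link2 a 0 = - ramp a :> R.
Proof.
rewrite /link2 oppr0 hinge_id//.
by case: (tent_piecewise (0 + 1 : R)) => -[? ->]; lra.
Qed.

(** The zero-chain property: [link1 0 b = 0], and [link2 a 0 = - ramp a] vanishes when [a] is 0 as
    well. Only entry [m] can survive, and only where [wt m] is nonzero. *)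
Lemma chain_grad_new wt x m (j : 'I_d) : (forall j : 'I_d, (m <= j)%N -> x 0 j = 0) ->
  (m <= j)%N -> chain_grad wt alpha lam x j =
    if j == m :> nat then - (alpha / lam * (wt m * ramp (coordz lam x m))) else 0.
Proof.
move=> xm mj; rewrite /chain_grad (@coordz_eq0 x m j.+1) ?ltnS ?mj ?ltn_ord//.
rewrite link1_0 mulr0 addr0 link2_0; case: eqP => [->|/eqP jm].
  by rewrite !mulrN.
rewrite (@coordz_eq0 x m j) ?ramp0 ?oppr0 ?mulr0// (ltnW (ltn_ord j)) andbT.
by rewrite ltn_neqAle eq_sym jm.
Qed.

(** Bounds the entry that the oracle randomises, hence its variance. *)
Lemma chain_grad_new_le wt w x (j : 'I_d) :
  (forall t, 0 <= wt t <= w) -> (forall k : 'I_d, (j <= k)%N -> x 0 k = 0) ->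
  `|chain_grad wt alpha lam x j| <= alpha / lam * w.
Proof.
move=> wtw xj; rewrite (chain_grad_new _ xj)// eqxx normrN normrM ger0_norm ?divr_ge0 ?(ltW lam_gt0)//.
rewrite ler_wpM2l ?divr_ge0 ?(ltW lam_gt0)// normrM.
have /andP[h0 h1] := wtw j; have /andP[r0 r1] := ramp_bounds (coordz lam x j).
by rewrite !ger0_norm// -[leRHS]mulr1 ler_pM.
Qed.

Lemma link1_le0 a b : link1 a b <= 0 :> R.
Proof.
have /andP[h0 _] := tent_bounds a; have /andP[r0 _] := ramp_bounds (b + 1).
by rewrite /link1 oppr_le0 mulr_ge0.
Qed.

(** For [b] in [0, 1/2), 1/16 is the product of [ramp (1/2) = 1/8] and of 1/2, which bounds the tent
    from below; for negative [b] the hinge makes up for the decay of the tent. *)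
Lemma link2_le a b : 1 / 2 <= a -> b < 1 / 2 -> link2 a b <= - (1 / 16) :> R.
Proof.
move=> a2 b2; have ra : 1 / 8 <= ramp a.
  by case: (ramp_piecewise a) => -[? ->]; nra.
rewrite /link2; have [b0|b0] := leP b 0.
  rewrite (@hinge_id _ (- b)); last lra.
  have /andP[r0 r1] := ramp_bounds a.
  by case: (tent_piecewise (b + 1)) => -[? ->]; nra.
rewrite (@hinge_eq0 _ (- b)); last lra.
by case: (tent_piecewise (b + 1)) => -[? ->]; nra.
Qed.

(* The first coordinate below 1/2 follows an active one, and is pushed up. *)
Lemma gradient_chain_large x (j0 : 'I_d) : x 0 j0 = 0 ->
  (alpha / lam / 16) ^+ 2 <= enorm (gradient (chain (fun=> 1) alpha lam) x) ^+ 2.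
Proof.
move=> xj0; have Ex : exists t, coordz lam x t < 1 / 2.
  by exists j0.+1; rewrite coordzS xj0 mul0r; lra.
(* The least such index is not 0, where the padding value is 2, so it has a predecessor, which is
   active. *)
case: (ex_minnP Ex) => [[|t]] /= tlt tmin; first by move: tlt; rewrite /coordz; lra.
have td : (t < d)%N.
  have := tmin j0.+1; rewrite coordzS xj0 mul0r => /(_ ltac:(lra)).
  by rewrite ltnS => /leq_ltn_trans; apply.
have ta : 1 / 2 <= coordz lam x t.
  by rewrite leNgt; apply/negP => /tmin; rewrite ltnn.
pose j := Ordinal td.
rewrite gradient_chain// sqr_enorm_row (bigD1 j)//= mxE.
apply: (@le_trans _ _ (chain_grad (fun=> 1) alpha lam x j ^+ 2)); last first.
  by rewrite lerDl sumr_ge0// => i _; exact: sqr_ge0.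
have al0 : 0 <= alpha / lam by rewrite divr_ge0// ltW.
rewrite -[leRHS]sqrrN ler_sqr ?nnegrE.
(* The outgoing link contributes with the same sign, so it cannot cancel the pull of the incoming
   one. *)
- rewrite /chain_grad !mul1r -mulrN ler_wpM2l//.
  have := link2_le ta tlt; have := link1_le0 (coordz lam x t.+1) (coordz lam x t.+2).
  by rewrite /=; lra.
- by rewrite divr_ge0.
- rewrite /chain_grad !mul1r -mulrN mulr_ge0//.
  have := link2_le ta tlt; have := link1_le0 (coordz lam x t.+1) (coordz lam x t.+2).
  by rewrite /=; lra.
Qed.

Lemma link_ge a b : - 1 <= link a b :> R.
Proof.
have /andP[h0 h1] := ramp_bounds a; have /andP[r0 r1] := ramp_bounds (b + 1).
have : 0 <= sqhinge (- b) by rewrite divr_ge0// sqr_ge0.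
by rewrite /link; nra.
Qed.

Lemma link_0_le0 a : link a 0 <= 0 :> R.
Proof.
have /andP[h0 h1] := ramp_bounds a; have /andP[r0 r1] := ramp_bounds (0 + 1 : R).
by rewrite /link /sqhinge oppr0 hinge_id// expr0n mul0r; nra.
Qed.

Lemma chain_ge x : - (alpha * d%:R) <= chain (fun=> 1) alpha lam x.
Proof.
rewrite /chain -mulrN ler_wpM2l//.
rewrite -[d in d%:R]card_ord -sumr_const -sumrN; apply: ler_sum => t _.
by rewrite mul1r link_ge.
Qed.

Lemma chain0_le0 : chain (fun=> 1) alpha lam (0 : 'rV[R]_d) <= 0.
Proof.
rewrite /chain mulr_ge0_le0// sumr_le0// => t _; rewrite mul1r.
by rewrite coordzS mxE mul0r link_0_le0.
Qed.

Context (n : nat) (wt : 'I_n -> nat -> R).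
Hypothesis n_gt0 : (0 < n)%N.
Hypothesis sum_wt : forall t, (t < d)%N -> \sum_i wt i t = n%:R.
Local Notation f := (fun i => @chain R d (wt i) alpha lam).

Lemma average_chain : average f = @chain R d (fun=> 1) alpha lam.
Proof.
apply/funext => x; rewrite /average /chain -mulr_sumr mulrCA; congr (_ * _).
rewrite exchange_big /= mulr_sumr; apply: eq_bigr => t _.
rewrite -mulr_suml sum_wt// mulrA mulVf// pnatr_eq0.
by rewrite -lt0n.
Qed.

Lemma chain_function_class (w L Delta : R) :
  (forall i t, 0 <= wt i t <= w) -> 0 <= L -> 5 * w * alpha <= L * lam ^+ 2 ->
  alpha * d%:R <= Delta -> function_class Delta L 0 f.
Proof.
move=> wtw L0 HL HD; split.
- by move=> i x; exact: differentiable_chain.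
- by move=> i x y; exact: (@gradient_chain_lipschitz _ _ _ _ _ _ _ w).
- rewrite average_chain.
  (* Each of the [d] links is at least -1, and the chain is at most 0 at the origin. *)
  have lb : ((- (alpha * d%:R))%:E <=
      ereal_inf [set (chain (fun=> 1) alpha lam x)%:E | x in [set: 'rV[R]_d]])%E.
    by apply: le_ereal_inf_tmp => _ [x _ <-]; rewrite lee_fin chain_ge.
  apply: (@le_trans _ _ (0%:E - (- (alpha * d%:R))%:E)%E).
    by apply: leeB => //; rewrite lee_fin chain0_le0.
  by rewrite -EFinB lee_fin sub0r opprK.
Qed.

End chain_landscape.

(** * The oracle *)

Section measurable_matrix_functions.
Context {d} {T : measurableType d}.

Lemma measurable_entry (m n : nat) i j :
  measurable_fun setT (fun A : 'M[T]_(m, n) => A i j).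
Proof.
move=> _ B mB; apply: sub_sigma_algebra; exists i, j; exists B => //.
Qed.

Lemma measurable_fun_mx {d'} {U : measurableType d'} (m n : nat) (F : U -> 'M[T]_(m, n)) :
  (forall i j, measurable_fun setT (fun u => F u i j)) -> measurable_fun setT F.
Proof.
move=> mF; apply: (measurability (@coord_preimages _ T m n)) => //.
move=> _ [_ [i [j [B mB <-]]] <-].
have := mF i j measurableT _ mB; rewrite !setTI; exact.
Qed.

End measurable_matrix_functions.

Section integral_coin.
Context {R : realType}.

Lemma integral_bernoulli_real (p : R) (g : bool -> R) : 0 <= p <= 1 ->
  (\int[bernoulli_prob p]_s (g s)%:E = (p * g true + (1 - p) * g false)%:E)%E.
Proof.
move=> p01; rewrite integralE.
rewrite !integral_bernoulli_prob//.
rewrite !funeposE !funenegE /= -!EFin_max -!EFinM -!EFinD.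
have E (h : R) : Num.max h 0 = h + Num.max (- h) 0.
  by case: (leP h 0) => ?; case: (leP (- h) 0) => ?; lra.
by congr (_%:E); rewrite (E (g true)) (E (g false)) /unstable.onem; ring.
Qed.

End integral_coin.

Section masked_oracle.
Context {R : realType} (d : nat) (alpha lam p : R).
Hypotheses (alpha_ge0 : 0 <= alpha) (lam_gt0 : 0 < lam) (p_gt0 : 0 < p) (p_le1 : p <= 1).
Implicit Types (x : 'rV[R]_d) (wt : nat -> R) (j : 'I_d) (s : bool).

(** A product of indicators, for the sake of measurability. *)
Definition undiscovered x j : R := \prod_(k < d | (j <= k)%N) (x 0 k == 0)%:R.

(* Only the new coordinate is randomised: randomising the whole gradient would
   make the variance grow with d. *)
Definition masked_grad wt x s : 'rV[R]_d :=
  \row_j (chain_grad wt alpha lam x j * (1 + undiscovered x j * (s%:R / p - 1))).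

Lemma undiscoveredP x j :
  reflect (forall k : 'I_d, (j <= k)%N -> x 0 k = 0) (undiscovered x j != 0).
Proof.
apply: (iffP idP) => [/prodf_neq0 H k jk|H].
  by have := H k jk; rewrite pnatr_eq0 eqb0 negbK => /eqP.
by apply/prodf_neq0 => k jk; rewrite H// eqxx oner_neq0.
Qed.

Lemma undiscovered1 x j : undiscovered x j != 0 -> undiscovered x j = 1.
Proof. by move/undiscoveredP => H; apply: big1 => k jk; rewrite H// eqxx. Qed.

(** The only new entry is number [m]; it carries the factor [wt m] and, for a failed coin, the
    factor [1 + (0 - 1)]. *)
Lemma masked_grad_span wt x m s : (forall k : 'I_d, (m <= k)%N -> x 0 k = 0) ->
  forall k : 'I_d, (m + (s && (wt m != 0%R)) <= k)%N -> masked_grad wt x s 0 k = 0.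
Proof.
move=> xm k mk; have mk' : (m <= k)%N by apply: leq_trans mk; exact: leq_addr.
rewrite mxE (chain_grad_new _ _ _ xm)//.
case: eqP => [km|]; last by rewrite mul0r.
have -> : undiscovered x k = 1.
  by apply/undiscovered1/undiscoveredP => l; rewrite km; exact: xm.
case: s mk => /= mk.
  have : wt m == 0 by move: mk; rewrite km -[leqRHS]addn0 leq_add2l leqn0 eqb0 negbK.
  by move/eqP ->; rewrite mul0r mulr0 oppr0 mul0r.
by rewrite mul0r sub0r mulrN mulr1 subrr mulr0.
Qed.

Lemma measurable_hinge : measurable_fun setT (@hinge R).
Proof. by apply: measurable_maxr. Qed.

Lemma measurable_tent : measurable_fun setT (@tent R).
Proof.
have mh (c : R) : measurable_fun setT (fun x : R => hinge (x - c)).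
  by apply: (measurableT_comp measurable_hinge); exact: measurable_funB.
apply: measurable_funD (mh 2); apply: measurable_funB; first exact: measurable_hinge.
exact: measurable_funM.
Qed.

Lemma measurable_ramp : measurable_fun setT (@ramp R).
Proof.
have mh (c : R) : measurable_fun setT (fun x : R => sqhinge (x - c)).
  apply: measurable_funM => //; apply: measurable_funX.
  by apply: (measurableT_comp measurable_hinge); exact: measurable_funB.
apply: measurable_funD (mh 2); apply: measurable_funB.
  apply: measurable_funM => //; apply: measurable_funX; exact: measurable_hinge.
exact: measurable_funM.
Qed.

Lemma measurable_coordz t : measurable_fun setT (fun x => coordz lam x t).
Proof.
case: t => [|t] //; rewrite /coordz; case: insubP => [j _ _|_]//.
by apply: measurable_funM => //; exact: measurable_entry.
Qed.

Lemma measurable_chain_grad wt j : measurable_fun setT (fun x => chain_grad wt alpha lam x j).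
Proof.
have mr t (c : R) : measurable_fun setT (fun x : 'rV[R]_d => ramp (coordz lam x t + c)).
  apply: (measurableT_comp measurable_ramp); apply: measurable_funD => //.
  exact: measurable_coordz.
have mt t (c : R) : measurable_fun setT (fun x : 'rV[R]_d => tent (coordz lam x t + c)).
  apply: (measurableT_comp measurable_tent); apply: measurable_funD => //.
  exact: measurable_coordz.
have mr0 t : measurable_fun setT (fun x : 'rV[R]_d => ramp (coordz lam x t)).
  by apply: (measurableT_comp measurable_ramp); exact: measurable_coordz.
have mt0 t : measurable_fun setT (fun x : 'rV[R]_d => tent (coordz lam x t)).
  by apply: (measurableT_comp measurable_tent); exact: measurable_coordz.
have mh t : measurable_fun setT (fun x : 'rV[R]_d => hinge (- coordz lam x t)).
  apply: (measurableT_comp measurable_hinge).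
  by apply: measurableT_comp => //; exact: measurable_coordz.
apply: measurable_funM => //; apply: measurable_funD; apply: measurable_funM => //.
  apply: measurable_funB; first exact: measurableT_comp.
  exact: measurable_funM.
by apply: measurableT_comp => //; exact: measurable_funM.
Qed.

Lemma measurable_undiscovered j : measurable_fun setT (fun x => undiscovered x j).
Proof.
rewrite /undiscovered; under eq_fun do rewrite big_mkcond.
apply: measurable_prod => k _; case: (j <= k)%N => //.
rewrite (_ : (fun x : 'rV[R]_d => (x 0 k == 0)%:R) =
             (\1_[set 0] : R -> R) \o (fun x : 'rV[R]_d => x 0 k)); last first.
  apply/funext => x /=; rewrite indicE; congr (nat_of_bool _)%:R.
  by apply/eqP/idP => [->|]; rewrite inE.
by apply: measurableT_comp; [exact: measurable_indic|exact: measurable_entry].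
Qed.

Lemma measurable_masked_grad wt :
  measurable_fun setT (fun q : 'rV[R]_d * bool => masked_grad wt q.1 q.2).
Proof.
apply: measurable_fun_mx => i j; under eq_fun do rewrite mxE.
apply: measurable_funM.
  exact: (measurableT_comp (measurable_chain_grad wt j) measurable_fst).
apply: measurable_funD => //; apply: measurable_funM.
  exact: (measurableT_comp (measurable_undiscovered j) measurable_fst).
have mb : measurable_fun setT (fun s : bool => s%:R / p - 1) by [].
exact: (measurableT_comp mb measurable_snd).
Qed.

Context (n : nat) (wt : 'I_n -> nat -> R) (w : R).
Hypothesis wt_bounds : forall i t, 0 <= wt i t <= w.

(** The coin divided by [p] has mean 1 and variance [(1 - p) / p]. *)
Lemma masked_grad_oracle (sigma : R) :
  (alpha / lam * w) ^+ 2 * ((1 - p) / p) <= sigma ^+ 2 ->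
  oracle_class sigma (fun i => @chain R d (wt i) alpha lam)
    (fun=> bernoulli_prob p) (fun i => masked_grad (wt i)).
Proof.
move=> Hsig; have p01 : 0 <= p <= 1 by rewrite ltW.
have pn0 : p != 0 by rewrite gt_eqF.
split.
- by move=> i; exact: measurable_masked_grad.
- move=> i x j; rewrite unlock integral_bernoulli_real// gradient_chain// !mxE.
  by congr (_%:E); rewrite mulr1n mulr0n; field.
- move=> i x; rewrite unlock integral_bernoulli_real// lee_fin.
  rewrite !sqr_enorm_row gradient_chain//.
  under eq_bigr do rewrite !mxE.
  under [X in _ + _ * X]eq_bigr do rewrite !mxE.
  rewrite !mulr_sumr -big_split /=.
  have E (g u : R) : p * (g * (1 + u * (true%:R / p - 1)) - g) ^+ 2 +
      (1 - p) * (g * (1 + u * (false%:R / p - 1)) - g) ^+ 2 = (g * u) ^+ 2 * ((1 - p) / p).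
    by rewrite mulr1n mulr0n; field.
  under eq_bigr do rewrite E.
  apply: le_trans Hsig; rewrite -mulr_suml ler_wpM2r ?divr_ge0 ?subr_ge0 ?(ltW p_gt0)//.
  (* At most one coordinate is both undiscovered and in the support of the gradient, so the sum
     reduces to a single term. *)
  have [/existsP[j]|] := boolP [exists j, chain_grad (wt i) alpha lam x j * undiscovered x j != 0].
    rewrite mulf_eq0 negb_or => /andP[gj uj].
    rewrite (bigD1 j)//= big1 ?addr0; last first.
      move=> k kj; apply/eqP; rewrite sqrf_eq0; apply: contraT.
      rewrite mulf_eq0 negb_or => /andP[gk uk].
      have /undiscoveredP xj := uj; have /undiscoveredP xk := uk.
      have [jk|jk] := leqP j k.
        by move: gk; rewrite (chain_grad_new _ _ _ xj)// val_eqE (negbTE kj) eqxx.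
      by move: gj; rewrite (chain_grad_new _ _ _ xk) ?(ltnW jk)// val_eqE [j == k]eq_sym (negbTE kj) eqxx.
    rewrite undiscovered1// mulr1 -real_normK ?num_real//.
    have /undiscoveredP xj := uj.
    have := chain_grad_new_le alpha_ge0 lam_gt0 (wt_bounds i) xj => h.
    by rewrite ler_sqr ?nnegrE// (le_trans _ h).
  rewrite negb_exists => /forallP H; rewrite big1 ?sqr_ge0// => j _.
  by have := H j; rewrite negbK => /eqP ->; rewrite expr0n.
Qed.

End masked_oracle.

(** * Linear spans and expectations *)

Section linear_span.
Context {R : realType} (d : nat).
Implicit Types x : 'rV[R]_d.

Definition first_coords (m : nat) : {vspace 'rV[R]_d} :=
  lker (linfun (mulmxr (diag_mx (\row_(k < d) (m <= k)%:R)) : 'rV[R]_d -> 'rV[R]_d)).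

Lemma first_coordsP m x :
  reflect (forall k : 'I_d, (m <= k)%N -> x 0 k = 0) (x \in first_coords m).
Proof.
rewrite memv_ker lfunE /=; apply: (iffP eqP) => [/rowP E k mk|H].
  by have := E k; rewrite mul_mx_diag !mxE mk mulr1.
apply/rowP => k; rewrite mul_mx_diag !mxE.
by case: (leqP m k) => mk; rewrite ?mulr0// H// mul0r.
Qed.

Lemma first_coords_sub m m' : (m <= m')%N -> (first_coords m <= first_coords m')%VS.
Proof.
move=> mm'; apply/subvP => x /first_coordsP xm; apply/first_coordsP => k m'k.
by apply: xm; exact: leq_trans m'k.
Qed.

Context (n : nat) (W : 'M[R]_n) (dX : measure_display) (X : measurableType dX).
Context (mu : 'I_n -> probability X R) (G : 'I_n -> 'rV[R]_d -> X -> 'rV[R]_d).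
Context (K : nat) (dT : measure_display) (T : measurableType dT) (P : probability T R).
Variable A : run W 0 mu G K P.
(* [lev k i w] bounds the coordinates known to node i before iteration k, and
   [lev' k i w] those it can send during iteration k. *)
Variables (lev lev' : nat -> 'I_n -> T -> nat).
Hypothesis lev_grad : forall k i w x, (k < K)%N -> x \in first_coords (lev k i w) ->
  G i x (noise A k i w) \in first_coords (lev' k i w).
Hypothesis lev_le : forall k i w, (k < K)%N -> (lev k i w <= lev' k i w)%N.
Hypothesis lev_step : forall k i j w, (k < K)%N ->
  (i == j) || (W i j != 0) -> (lev' k j w <= lev k.+1 i w)%N.

(** By induction on [k], gradients and messages of iteration [k] stay within [lev'], and [lev_step]
    carries this over each edge and over each node's own memory. *)
Lemma memory_sub k i w : (k <= K)%N ->
  (memory W 0 G (noise A) (query A) (@msg _ _ _ _ _ _ _ _ _ _ _ _ _ A) k i w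
   <= first_coords (lev k i w))%VS.
Proof.
elim: k i w => [|k IH] i w kK; first by rewrite -memvE mem0v.
have kK' := ltnW kK.
have grad j : G j (query A k j w) (noise A k j w) \in first_coords (lev' k j w).
  by apply: lev_grad => //; apply: (subvP (IH _ _ kK')); exact: query_span.
have stepi := first_coords_sub (lev_step w kK (i := i) (j := i) ltac:(by rewrite eqxx)).
rewrite /= !subv_add; apply/andP; split; first (apply/andP; split).
- apply: subv_trans (IH _ _ kK') _; apply: subv_trans stepi.
  exact/first_coords_sub/lev_le.
- by rewrite -memvE; apply: (subvP stepi).
- apply/span_subvP => _ /mapP[l _ ->]; apply: memv_suml => j _.
  have [->|Wij] := eqVneq (W i j) 0; first by rewrite scale0r mem0v.
  apply/memvZ/(subvP (first_coords_sub (lev_step w kK (i := i) (j := j) ltac:(by rewrite Wij orbT)))).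
  have := msg_span l j w kK.
  apply: subvP; rewrite subv_add; apply/andP; split; last by rewrite -memvE.
  apply: subv_trans (IH _ _ kK') _; exact/first_coords_sub/lev_le.
Qed.

Lemma output_first_coords w m : (forall k i, (k <= K)%N -> (lev k i w <= m)%N) ->
  output A w \in first_coords m.
Proof.
move=> levm; apply: (subvP _ _ (output_span A w)); apply/span_subvP.
move=> _ /allpairsP[[k i] /= [kK _ ->]].
have {}kK : (k <= K)%N.
  by move: (kK : k \in iota 0 K.+1); rewrite mem_iota add0n ltnS.
apply: (subvP (first_coords_sub (levm k i kK))).
by apply: (subvP (memory_sub i w kK)); exact: sol_span.
Qed.

End linear_span.

(** * Lower bounds on expectations *)

Section expectation_bounds.
Context {R : realType}.

(* Unlike [ge0_le_integral], without measurability. *)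
Lemma le_integral_ge0 {dT} {T : measurableType dT} (mu : {measure set T -> \bar R})
    (f g : T -> \bar R) : (forall x, 0 <= f x)%E -> (forall x, f x <= g x)%E ->
  (\int[mu]_x f x <= \int[mu]_x g x)%E.
Proof.
move=> f0 fg; have g0 x : (0 <= g x)%E by exact: le_trans (fg x).
rewrite !ge0_integralTE//; apply: ereal_sup_le => _ [h /= hf <-].
by exists h => // x; exact: le_trans (fg x).
Qed.

Lemma expectation_ge_cst {dT} {T : measurableType dT} (P : probability T R)
    (g : T -> R) (c : R) : 0 <= c -> (forall w, c <= g w) -> (c%:E <= 'E_P[g])%E.
Proof.
move=> c0 cg; rewrite unlock.
apply: (@le_trans _ _ (\int[P]_w (cst c%:E) w)%E).
  by rewrite integral_cst//; have /= -> := probability_setT P; rewrite mule1.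
by apply: le_integral_ge0 => w; rewrite lee_fin.
Qed.

Context (n d : nat) (W : 'M[R]_n) (x0 : 'rV[R]_d) (p : R).
Context (G : 'I_n -> 'rV[R]_d -> bool -> 'rV[R]_d).
Context (K : nat) (dT : measure_display) (T : measurableType dT) (P : probability T R).
Variable A : run W x0 (fun=> bernoulli_prob p) G K P.
Hypothesis p01 : 0 <= p <= 1.

Lemma measurable_noise k i : (k < K)%N -> measurable (noise A k i @^-1` [set true]).
Proof.
move=> kK; apply: (@filt_sub _ _ _ _ _ _ _ _ _ _ _ _ _ A k.+1).
apply: (@noise_adapted _ _ _ _ _ _ _ _ _ _ _ _ _ A k i kK).
by exists [set true] => //; rewrite setTI.
Qed.

Lemma noise_success k i : (k < K)%N -> P (noise A k i @^-1` [set true]) = p%:E.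
Proof.
move=> kK.
have FT : filt A k setT.
  have [F0 FC _] := @filt_sigma _ _ _ _ _ _ _ _ _ _ _ _ _ A k.
  by have := FC _ F0; rewrite setD0.
have := @noise_independent _ _ _ _ _ _ _ _ _ _ _ _ _ A k setT
  (fun j => if j == i then [set true] else setT) kK FT.
have mB j : measurable (if j == i then [set true] else setT) by [].
move=> /(_ mB); rewrite setTI probability_setT mul1e.
rewrite (bigD1 i)//= eqxx big1 ?mule1; last first.
  by move=> j /negbTE ->; exact: probability_setT.
rewrite bernoulli_probE// !diracE mem_set// memNset// mule1 mule0 adde0 => <-.
congr (P _); apply/seteqP; split=> [w wi j _|w /(_ i I)]; last by rewrite eqxx.
by case: eqP => // ->.
Qed.

(** Markov's inequality for the number [s] of successful coins, of mean [K n p], through the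
    measurable minorant [c max(1 - s / m, 0)] of [g]. *)
Lemma expectation_ge_coin (g : T -> R) (c : R) (m : nat) :
  (0 < m)%N -> 0 <= c -> (forall w, 0 <= g w) ->
  (forall w, (\sum_(k < K) \sum_(i < n) noise A k i w < m)%N -> c <= g w) ->
  ((c * (1 - K%:R * n%:R * p / m%:R))%:E <= 'E_P[g])%E.
Proof.
move=> m0 c0 g0 cg.
pose B (k : 'I_K) (i : 'I_n) := noise A k i @^-1` [set true].
have mB k i : measurable (B k i) by exact: measurable_noise.
pose s w : R := \sum_(k < K) \sum_(i < n) \1_(B k i) w.
have sE w : s w = (\sum_(k < K) \sum_(i < n) noise A k i w)%N%:R.
  rewrite /s natr_sum; apply: eq_bigr => k _; rewrite natr_sum; apply: eq_bigr => i _.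
  rewrite indicE; congr (nat_of_bool _)%:R.
  by apply/idP/idP => [/set_mem|/mem_set].
have ms : measurable_fun setT s.
  by apply: measurable_sum => k; apply: measurable_sum => i; exact: measurable_indic.
have s0 w : 0 <= s w by rewrite sE.
have mR : 0 < m%:R :> R by rewrite ltr0n.
pose phi w : R := c * Num.max (1 - s w / m%:R) 0.
have phi0 w : 0 <= phi w by rewrite mulr_ge0// le_max lexx orbT.
have mphi : measurable_fun setT phi.
  apply: measurable_funM => //; apply: measurable_maxr => //.
  by apply: measurable_funB => //; exact: measurable_funM.
have Ek k : (\int[P]_w (\sum_(i < n) \1_(B k i) w)%:E = (n%:R * p)%:E)%E.
  under eq_integral do rewrite -sumEFin.
  rewrite ge0_integral_sum//=; last first.
    by move=> i; apply/measurable_EFinP; exact: measurable_indic.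
  rewrite (eq_bigr (fun=> p%:E)).
    by rewrite sumEFin sumr_const card_ord mulr_natl.
  by move=> i _; rewrite integral_indic// setIT; exact: noise_success.
have Es : (\int[P]_w (s w)%:E = (K%:R * n%:R * p)%:E)%E.
  under eq_integral do rewrite /s -sumEFin.
  rewrite ge0_integral_sum//=; last 2 first.
  - move=> k; apply/measurable_EFinP; apply: measurable_sum => i.
    exact: measurable_indic.
  - by move=> k w _; rewrite lee_fin sumr_ge0.
  under eq_bigr do rewrite Ek.
  by rewrite sumEFin sumr_const card_ord -mulrA [K%:R * _]mulr_natl.
have le_phi : (\int[P]_w (phi w)%:E <= 'E_P[g])%E.
  rewrite unlock; apply: le_integral_ge0 => w; rewrite lee_fin//.
  rewrite /phi; have [sm|sm] := ltP (s w) m%:R.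
    apply: (@le_trans _ _ c); last by apply: cg; move: sm; rewrite sE ltr_nat.
    rewrite -[leRHS]mulr1 ler_wpM2l// ge_max ler01 andbT gerBl.
    by rewrite divr_ge0// ltW.
  have -> : Num.max (1 - s w / m%:R) 0 = 0.
    by apply/max_idPr; rewrite subr_le0 ler_pdivlMr// mul1r.
  by rewrite mulr0.
apply: le_trans le_phi.
(* A sum rather than a difference, so that only nonnegative functions are integrated. *)
have : (c%:E <= \int[P]_w (phi w)%:E + (c / m%:R)%:E * \int[P]_w (s w)%:E)%E.
  rewrite -ge0_integralZl_EFin//; first last.
  - by rewrite divr_ge0// ltW.
  - exact/measurable_EFinP.
  - by move=> w _; rewrite lee_fin.
  rewrite -ge0_integralD//; first last.
  - by apply/measurable_EFinP; exact: measurable_funM.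
  - by move=> w _; rewrite lee_fin mulr_ge0// divr_ge0// ltW.
  - exact/measurable_EFinP.
  - by move=> w _; rewrite lee_fin.
  apply: (@le_trans _ _ (\int[P]_w (cst c%:E) w)%E).
    by rewrite integral_cst//; have /= -> := probability_setT P; rewrite mule1.
  apply: le_integral_ge0 => w; rewrite ?lee_fin//.
  rewrite -[c / m%:R * s w]mulrA [_^-1 * _]mulrC -mulrDr -[leLHS]mulr1 ler_wpM2l//.
  by rewrite -lerBlDr le_max lexx.
rewrite Es -EFinM -leeBlDr//.
by rewrite -EFinB; congr (_%:E <= _)%E; ring.
Qed.

End expectation_bounds.

(** * Hard instances *)

Section chain_instance.
Context {R : realType} (n m : nat) (L Delta w : R) (wt : 'I_n -> nat -> R).
Hypotheses (n_gt0 : (0 < n)%N) (L_gt0 : 0 < L) (Delta_gt0 : 0 < Delta) (w_gt0 : 0 < w).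
Hypothesis wt_bounds : forall i t, 0 <= wt i t <= w.
Hypothesis sum_wt : forall t, \sum_i wt i t = n%:R.

(** Height and scale exhaust both budgets of the class: [alpha d = Delta] and
    [5 w alpha = L lam ^ 2]. *)
Definition chain_height : R := Delta / m.+1%:R.
Definition chain_scale : R := Num.sqrt (5 * w * chain_height / L).
Definition chain_family (i : 'I_n) : 'rV[R]_m.+1 -> R :=
  @chain R m.+1 (wt i) chain_height chain_scale.

Lemma chain_height_gt0 : 0 < chain_height.
Proof. by rewrite divr_gt0// ltr0n. Qed.

Lemma chain_scale_gt0 : 0 < chain_scale.
Proof. by rewrite sqrtr_gt0 divr_gt0// !mulr_gt0// chain_height_gt0. Qed.

Lemma sqr_chain_slope :
  (chain_height / chain_scale) ^+ 2 = L * Delta / (5 * w * m.+1%:R).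
Proof.
have h0 := chain_height_gt0.
rewrite expr_div_n sqr_sqrtr; last by rewrite ltW// divr_gt0// !mulr_gt0.
have -> : chain_height ^+ 2 / (5 * w * chain_height / L) = L * chain_height / (5 * w).
  by field; rewrite !gt_eqF.
rewrite /chain_height; move: (ltr0Sn R m); move: m.+1%:R => M M0.
by field; rewrite !gt_eqF.
Qed.

Lemma chain_family_class : function_class Delta L 0 chain_family.
Proof.
have h0 := chain_height_gt0.
apply: (chain_function_class (ltW h0) chain_scale_gt0 n_gt0 _ wt_bounds) => //.
- exact: ltW.
- rewrite sqr_sqrtr; last by rewrite ltW// divr_gt0// !mulr_gt0.
  by rewrite [L * _]mulrC divfK// gt_eqF.
- by rewrite divfK// pnatr_eq0.
Qed.

(** The last coordinate is still 0; [64 * 20 = 16 ^ 2 * 5] joins the 1/16 of the pull to the 5 of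
    the slope. *)
Lemma chain_family_gradient (x : 'rV[R]_m.+1) : x \in first_coords m.+1 m ->
  L * Delta / (64 * 20 * w * m.+1%:R) <= enorm (gradient (average chain_family) x) ^+ 2.
Proof.
move=> /first_coordsP xm.
rewrite average_chain//.
have x0 : x 0 ord_max = 0 by apply: xm.
apply: le_trans (gradient_chain_large (ltW chain_height_gt0) chain_scale_gt0 x0).
rewrite expr_div_n sqr_chain_slope; move: (ltr0Sn R m); move: m.+1%:R => M M0.
by rewrite le_eqVlt; apply/orP; left; apply/eqP; field; rewrite !gt_eqF.
Qed.

Context (p : R).
Hypotheses (p_gt0 : 0 < p) (p_le1 : p <= 1).

Definition chain_oracle (i : 'I_n) (x : 'rV[R]_m.+1) (s : bool) : 'rV[R]_m.+1 :=
  masked_grad chain_height chain_scale p (wt i) x s.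

Lemma chain_oracle_class (sigma : R) :
  L * Delta * w / (5 * m.+1%:R) * ((1 - p) / p) <= sigma ^+ 2 ->
  oracle_class sigma chain_family (fun=> bernoulli_prob p) chain_oracle.
Proof.
move=> H; have slope : (chain_height / chain_scale * w) ^+ 2 = L * Delta * w / (5 * m.+1%:R).
  rewrite exprMn sqr_chain_slope; move: (ltr0Sn R m); move: m.+1%:R => M M0.
  by field; rewrite !gt_eqF.
rewrite -slope in H.
exact: (@masked_grad_oracle R m.+1 _ _ p (ltW chain_height_gt0) chain_scale_gt0
  p_gt0 p_le1 n wt w wt_bounds sigma H).
Qed.

Lemma chain_oracle_span i x s l : x \in first_coords m.+1 l ->
  chain_oracle i x s \in first_coords m.+1 (l + (s && (wt i l != 0%R))).
Proof.
move=> /first_coordsP xl; apply/first_coordsP => k lk.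
exact: masked_grad_span xl _ lk.
Qed.

End chain_instance.

(** The conclusion of the theorem for fixed [W] and [K], with a free bound [c], shared by the
    degenerate case and the two hard instances. *)
Definition forced_gradient {R : realType} (n : nat) (W : 'M[R]_n) (L Delta sigma : R)
    (K : nat) (c : R) :=
  exists (d : nat) (x0 : 'rV[R]_d) (f : 'I_n -> 'rV[R]_d -> R)
         (dX : measure_display) (X : measurableType dX)
         (mu : 'I_n -> probability X R)
         (G : 'I_n -> 'rV[R]_d -> X -> 'rV[R]_d),
    [/\ (1 <= d)%N, function_class Delta L x0 f,
        oracle_class sigma f mu G &
    forall (dT : measure_display) (T : measurableType dT)
           (P : probability T R) (A : run W x0 mu G K P),
      (c%:E <= 'E_P[fun w => (enorm (gradient (average f) (output A w)) ^+ 2)%R])%E].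

Lemma forced_gradient_le {R : realType} n (W : 'M[R]_n) L Delta sigma K (c c' : R) :
  c' <= c -> forced_gradient W L Delta sigma K c -> forced_gradient W L Delta sigma K c'.
Proof.
move=> cc' [d [x0 [f [dX [X [mu [G [d1 fc oc H]]]]]]]].
exists d, x0, f, dX, X, mu, G; split => // dT T P A.
by apply: le_trans (H _ _ P A); rewrite lee_fin.
Qed.

Section instances.
Context {R : realType}.

(** With [alpha = 0] the chain is the zero function; this serves the case [L * Delta = 0]. *)
Lemma forced_gradient_trivial n (W : 'M[R]_n) (L Delta sigma : R) K : (0 < n)%N ->
  0 <= L -> 0 <= Delta -> forced_gradient W L Delta sigma K 0.
Proof.
move=> n0 L0 D0; pose wt (i : 'I_n) (t : nat) : R := 1.
exists 1%N, 0, (fun i => @chain R 1 (wt i) 0 1), _, bool, (fun=> bernoulli_prob 1),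
  (fun i => masked_grad 0 1 1 (wt i)).
split => //.
- apply: (@chain_function_class R 1 0 1 _ _ n wt n0 _ 1) => //.
  + by move=> t _; rewrite sumr_const card_ord.
  + by move=> i t; rewrite ler01 lexx.
  + by rewrite mulr0 expr1n mulr1.
  + by rewrite mul0r.
- apply: (@masked_grad_oracle R 1 0 1 1 _ _ _ _ n wt 1) => //.
  + by move=> i t; rewrite ler01 lexx.
  + by rewrite !mul0r expr0n mul0r sqr_ge0.
- move=> dT T P A; apply: expectation_ge_cst => // w; exact: sqr_ge0.
Qed.

Lemma forced_gradient_noise n (W : 'M[R]_n) (L Delta sigma : R) K : (0 < n)%N -> (0 < K)%N ->
  0 < L -> 0 < Delta -> 0 < sigma ->
  sigma <= Num.sqrt (L * Delta) * Num.sqrt (n%:R * K%:R) ->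
  forced_gradient W L Delta sigma K
    (sigma * Num.sqrt (L * Delta) / Num.sqrt (n%:R * K%:R) / (64 * 50)).
Proof.
move=> n0 K0 L0 D0 s0 sle.
set a := Num.sqrt (L * Delta) in sle *; set b := Num.sqrt (n%:R * K%:R) in sle *.
have LD0 : 0 < L * Delta by rewrite mulr_gt0.
have nK0 : 0 < n%:R * K%:R :> R by rewrite mulr_gt0// ltr0n.
have a2 : a ^+ 2 = L * Delta by rewrite sqr_sqrtr// ltW.
have b2 : b ^+ 2 = n%:R * K%:R by rewrite sqr_sqrtr// ltW.
have a0 : 0 < a by rewrite sqrtr_gt0.
have b0 : 0 < b by rewrite sqrtr_gt0.
(* The first term of the rate is [L Delta / q], the order of the squared gradient of a chain of
   length [q]; the actual length [m.+1] lies between [q] and [2 q]. *)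
pose q := a * b / sigma.
have q1 : 1 <= q by rewrite ler_pdivlMr// mul1r.
have /truncn_itv/andP[mq qm] : 0 <= q by lra.
set m := Num.truncn q in mq qm.
have m0 : 0 < m.+1%:R :> R by rewrite ltr0n.
have m2q : m.+1%:R <= 2 * q by rewrite -natr1; lra.
(* The oracle has variance at most [v sigma ^ 2 (1 - p) / p], which [p = v] keeps below [sigma ^ 2];
   if [v >= 1] the oracle is exact. *)
pose v := L * Delta / (5 * m.+1%:R * sigma ^+ 2).
have v0 : 0 < v by rewrite divr_gt0// !mulr_gt0// exprn_gt0.
pose p := Num.min 1 v.
have p0 : 0 < p by rewrite lt_min ltr01.
have p1 : p <= 1 by rewrite ge_min lexx.
have pv : p <= v by rewrite ge_min lexx orbT.
pose wt (i : 'I_n) (t : nat) : R := 1.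
have wtb i t : 0 <= wt i t <= 1 by rewrite ler01 lexx.
have swt t : \sum_i wt i t = n%:R by rewrite sumr_const card_ord.
exists m.+1, 0, (@chain_family R n m L Delta 1 wt), _, bool, (fun=> bernoulli_prob p),
  (@chain_oracle R n m L Delta 1 wt p).
split => //; first exact: chain_family_class.
  apply: chain_oracle_class => //.
  have -> : L * Delta * 1 / (5 * m.+1%:R) = v * sigma ^+ 2.
    rewrite /v; move: m0; move: m.+1%:R => M M0.
    by field; rewrite !gt_eqF.
  rewrite mulrAC -[leRHS]mul1r ler_wpM2r ?sqr_ge0//.
  rewrite /p; case: (leP 1 v) => v1; first by rewrite subrr mul0r mulr0.
  by rewrite mulrCA mulfV ?gt_eqF// mulr1; lra.
move=> dT T P A.
set c := L * Delta / (64 * 20 * 1 * m.+1%:R).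
have c0 : 0 < c.
  by apply: (divr_gt0 LD0); rewrite mulr1; apply: mulr_gt0 m0; lra.
have p01 : 0 <= p <= 1 by rewrite ltW.
(* Successes at all nodes are counted, as if every discovery were shared at once. *)
pose lev k (i : 'I_n) (w : T) := (\sum_(l < k) \sum_(j < n) noise A l j w)%N.
pose lev' k (i : 'I_n) (w : T) := (lev k i w + noise A k i w)%N.
pose g w := enorm (gradient (average (@chain_family R n m L Delta 1 wt)) (output A w)) ^+ 2.
have Hg w : (\sum_(k < K) \sum_(i < n) noise A k i w < m.+1)%N -> c <= g w.
  move=> lw; apply: chain_family_gradient => //.
  apply: (@output_first_coords R _ n W _ bool _ _ K dT T P A lev lev').
  - move=> k i u x kK xk.
    have := @chain_oracle_span R n m L Delta 1 wt p i x (noise A k i u) _ xk.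
    by rewrite /wt oner_neq0 andbT.
  - by move=> k i u kK; exact: leq_addr.
  - move=> k i j u kK _; rewrite /lev' /lev big_ord_recr /= leq_add2l.
    by rewrite (bigD1 j)//= leq_addr.
  - move=> k i kK; rewrite -ltnS; apply: leq_ltn_trans lw.
    rewrite /lev (big_ord_widen _ (fun l => \sum_(j < n) noise A l j w)%N kK).
    by rewrite [leqRHS](bigID (fun l : 'I_K => (l < k)%N)) /= leq_addr.
have g0 w : 0 <= g w by exact: sqr_ge0.
apply: le_trans (expectation_ge_coin p01 (ltn0Sn m) (ltW c0) g0 Hg).
rewrite lee_fin.
(* The mean number of discoveries is at most a fifth of the length, whence a loss of 4/5 only. *)
have pq : K%:R * n%:R * p / m.+1%:R <= 1 / 5.
  apply: (@le_trans _ _ (K%:R * n%:R * v / m.+1%:R)).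
    by rewrite ler_wpM2r ?invr_ge0 ?ler0n// ler_wpM2l// mulr_ge0.
  have -> : K%:R * n%:R * v / m.+1%:R = (q / m.+1%:R) ^+ 2 / 5.
    rewrite /v /q -a2 [K%:R * _]mulrC -b2; move: m0; move: m.+1%:R => M M0.
    by field; rewrite !gt_eqF.
  have : q / m.+1%:R <= 1 by rewrite ler_pdivrMr// mul1r ltW.
  have : 0 <= q / m.+1%:R by rewrite divr_ge0//; lra.
  by move: (q / _) => z ? ?; nra.
move: pq; move: (K%:R * n%:R * p / m.+1%:R) => X pq.
apply: (@le_trans _ _ (c * (4 / 5))); last by rewrite ler_wpM2l ?(ltW c0)//; lra.
have -> : sigma * a / b / (64 * 50) = (L * Delta) / (q * (64 * 50)).
  by rewrite -a2 /q; field; rewrite !gt_eqF.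
have -> : c * (4 / 5) = (L * Delta) / (m.+1%:R * (64 * 25)).
  rewrite /c; move: m0; move: m.+1%:R => M M0.
  by field; rewrite !gt_eqF.
by rewrite ler_wpM2l ?(ltW LD0)// lef_pV2 ?posrE; lra.
Qed.

End instances.

(** * The relay schedule *)

Section relay_levels.
Variables (n r : nat).

(* The first r nodes can discover the coordinates of even index and the last r
   nodes those of odd index. *)
Definition relay_active (i l : nat) : bool :=
  ((i < r) && ~~ odd l || (n - r <= i) && odd l)%N.

(* What the first r nodes discover needs n - 2 r + 1 hops to reach the last r
   nodes, whose answer takes one more hop to node 0. *)
Definition relay_period : nat := (n - 2 * r + 2)%N.

(** A cap on what node [i] knows before iteration [k]. A period starts with an even level
    everywhere; the first [r] nodes find the next coordinate in its first iteration and, as it is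
    sent at once, node [i >= r] has it after [i - (r - 1)] iterations. *)
Definition relay_level (k i : nat) : nat :=
  (2 * (k %/ relay_period) + (maxn 1 (i - r.-1) <= k %% relay_period))%N.

Lemma relay_level_le k K i : (k <= K)%N ->
  (relay_level k i <= (2 * (K %/ relay_period)).+1)%N.
Proof.
move=> kK; rewrite /relay_level -[leqRHS]addn1 leq_add ?leq_b1//.
by rewrite leq_mul2l leq_div2r.
Qed.

(** Here [r] is [n / 3] rounded up and a period is at least [n / 3]: full periods account for [6 K],
    and the extra [2 n] is at most [4 K]. *)
Lemma relay_horizon e K : (e < 3)%N -> (n + 2 = r * 3 + e)%N -> (n <= 2 * K)%N ->
  ((2 * (K %/ relay_period)).+2 * n <= 10 * K)%N.
Proof.
move=> e3 rE nK; have n3 : (n <= 3 * relay_period)%N by rewrite /relay_period; lia.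
have qK := leq_trunc_div K relay_period.
have : (K %/ relay_period * n <= 3 * K)%N.
  by rewrite (leq_trans (leq_mul (leqnn _) n3))// mulnCA leq_mul2l.
by clear -nK; nia.
Qed.

Hypotheses (r_gt0 : (0 < r)%N) (r2n : (2 * r <= n)%N).

Lemma relay_level_step k i j : (j < n)%N -> [\/ i = j, i = 0 | i = j.+1]%N ->
  (relay_level k j + relay_active j (relay_level k j) <= relay_level k.+1 i)%N.
Proof.
move=> jn ij; rewrite /relay_level.
have D0 : (0 < relay_period)%N by rewrite /relay_period addn2.
have := divn_eq k relay_period; have := ltn_pmod k D0.
set q := (k %/ _)%N; set s := (k %% _)%N => sD kE.
(* The parity of the level decides which group can make the next discovery. *)
have oddq b : odd (2 * q + nat_of_bool b) = b by rewrite oddD mul2n odd_double; case: b.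
rewrite /relay_active oddq.
(* Before the last iteration of a period the new coordinate has not reached the last [r] nodes; when
   the period ends, every node is credited with both discoveries. *)
have [s1|s1] := ltnP s.+1 relay_period.
  have -> : (k.+1 %/ relay_period)%N = q by rewrite kE -addnS divnMDl// divn_small// addn0.
  have -> : (k.+1 %% relay_period)%N = s.+1 by rewrite kE -addnS modnMDl modn_small.
  rewrite /relay_period in sD s1.
  by case: ij => ->; lia.
have sE : s.+1 = relay_period by apply/eqP; rewrite eqn_leq s1 sD.
have -> : (k.+1 %/ relay_period)%N = q.+1.
  by rewrite kE -addnS sE -mulSnr mulnK.
have -> : (k.+1 %% relay_period)%N = 0%N by rewrite kE -addnS sE -mulSnr modnMl.
lia.
Qed.

End relay_levels.

Lemma sum_lt_ord (R : realType) (n r : nat) (c : R) : (r <= n)%N ->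
  \sum_(i < n) (if (i < r)%N then c else 0) = c *+ r.
Proof.
move=> rn; rewrite -big_mkcond /= -(big_ord_widen n (fun=> c) rn).
by rewrite sumr_const card_ord.
Qed.

(** Each link is held by [r] nodes with weight [n / r], at most 3, and the oracle is exact. The
    constant is [64 * 20 * 3 * 10 = 128 * 300]. *)
Lemma forced_gradient_relay (R : realType) n (W : 'M[R]_n) (L Delta sigma : R) K :
  (2 <= n)%N -> (n <= 2 * K)%N -> 0 < L -> 0 < Delta ->
  (forall i j, W i j != 0 -> i = 0%N :> nat \/ i = j.+1 :> nat) ->
  forced_gradient W L Delta sigma K (L * Delta * n%:R / (128 * 300 * K%:R)).
Proof.
move=> n2 nK L0 D0 WE.
have n0 : (0 < n)%N by lia.
pose r := ((n + 2) %/ 3)%N.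
have := divn_eq (n + 2) 3; have := ltn_pmod (n + 2) (isT : 0 < 3)%N.
rewrite -/r; move: (_ %% 3)%N => e e3 rE.
have r0 : (0 < r)%N by lia.
have r2n : (2 * r <= n)%N by lia.
(* The cap on all levels up to time [K]; coordinate [m], the last one, stays undiscovered. *)
pose m := (2 * (K %/ relay_period n r)).+1.
pose wt (i : 'I_n) t : R := if relay_active n r i t then n%:R / r%:R else 0.
have rR : 0 < r%:R :> R by rewrite ltr0n.
have nr3 : n%:R / r%:R <= 3 :> R.
  by rewrite ler_pdivrMr// -natrM ler_nat; lia.
have nr0 : 0 < n%:R / r%:R :> R by rewrite divr_gt0// ltr0n.
have wtb i t : 0 <= wt i t <= 3.
  by rewrite /wt; case: ifP => _; apply/andP; split => //; lra.
have swt t : \sum_i wt i t = n%:R.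
  have E : n%:R / r%:R *+ r = n%:R :> R by rewrite -mulr_natr divfK// gt_eqF.
  have rn : (r <= n)%N by lia.
  rewrite -[RHS]E -(sum_lt_ord _ rn) /wt /relay_active.
  case: (odd t); last by apply: eq_bigr => i _; rewrite andbT andbF orbF.
  (* The last [r] nodes are the mirror image of the first [r]. *)
  rewrite [RHS](reindex_inj rev_ord_inj) /=; apply: eq_bigr => i _.
  rewrite andbF andbT /=; congr (if _ then _ else _).
  by have := ltn_ord i; lia.
have wt_neq0 i t : wt i t != 0 -> relay_active n r i t.
  by rewrite /wt; case: ifP => //; rewrite eqxx.
exists m.+1, 0, (@chain_family R n m L Delta 3 wt), _, bool, (fun=> bernoulli_prob 1),
  (@chain_oracle R n m L Delta 3 wt 1).
have w0 : 0 < 3 :> R by lra.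
split => //; first exact: chain_family_class.
  apply: chain_oracle_class => //.
  by rewrite subrr mul0r mulr0 sqr_ge0.
move=> dT T P A.
pose lev k (i : 'I_n) (w : T) := relay_level n r k i.
pose lev' k (i : 'I_n) (w : T) := (lev k i w + relay_active n r i (lev k i w))%N.
have K0 : 0 < K%:R :> R by rewrite ltr0n; lia.
have LD0 : 0 < L * Delta by rewrite mulr_gt0.
have nR0 : 0 < n%:R :> R by rewrite ltr0n.
apply: expectation_ge_cst => [|w].
  apply: divr_ge0; first by rewrite mulr_ge0 ?(ltW LD0) ?(ltW nR0).
  by apply: mulr_ge0; [lra|exact: ltW].
apply: (@le_trans _ _ (L * Delta / (64 * 20 * 3 * m.+1%:R))); last first.
  apply: chain_family_gradient => //.
  apply: (@output_first_coords R _ n W _ bool _ _ K dT T P A lev lev').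
  - move=> k i u x kK xk.
    have := @chain_oracle_span R n m L Delta 3 wt 1 i x (noise A k i u) _ xk.
    apply: (subvP (first_coords_sub _ _)); rewrite /lev' leq_add2l.
    by case: (noise A k i u) => //=; have := wt_neq0 i (lev k i u); case: eqP => //= _ ->.
  - by move=> k i u kK; exact: leq_addr.
  - move=> k i j u kK ij; apply: relay_level_step => //.
    case/orP: ij => [/eqP ->|/WE[]]; [exact: Or31|exact: Or32|exact: Or33].
  - by move=> k i kK; exact: relay_level_le.
have mK : (m.+1 * n <= 10 * K)%N by apply: relay_horizon e3 rE nK.
have mKR : m.+1%:R * n%:R <= 10 * K%:R :> R by rewrite -!natrM ler_nat.
have m0 : 0 < m.+1%:R :> R by rewrite ltr0n.
move: mKR m0; move: m.+1%:R => M mKR M0.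
have -> : L * Delta * n%:R / (128 * 300 * K%:R) = L * Delta * (n%:R / (128 * 300 * K%:R)).
  by rewrite mulrA.
rewrite ler_wpM2l ?(ltW LD0)//.
rewrite ler_pdivrMr; last by apply: mulr_gt0 K0; lra.
rewrite mulrC ler_pdivlMr; last by apply: mulr_gt0 M0; lra.
lra.
Qed.


(** * Choice between the two instances *)

Theorem theorem1 (R : realType) (beta0 : R) (beta0_gt0 : 0 < beta0) :
  exists c1 c2 : R, [/\ 0 < c1, 0 < c2 &
  forall (L Delta sigma : R) (n : nat) (betat : R),
    0 <= L -> 0 <= Delta -> 0 <= sigma -> (2 <= n)%N ->
    beta0 <= betat -> betat <= 1 - n%:R^-1 ->
  exists (W : 'M[R]_n) (pi : 'cV[R]_n),
    [/\ mixing_matrix W, equilibrium W pi, beta W pi = betat,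
        c1 * (n%:R * (1 - beta W pi)) <= ln (kappa pi) &
    forall K : nat, (0 < K)%N ->
      rate L Delta sigma n (beta W pi) (kappa pi) K <= L * Delta ->
    exists (d : nat) (x0 : 'rV[R]_d) (f : 'I_n -> 'rV[R]_d -> R)
           (dX : measure_display) (X : measurableType dX)
           (mu : 'I_n -> probability X R)
           (G : 'I_n -> 'rV[R]_d -> X -> 'rV[R]_d),
      [/\ (1 <= d)%N, function_class Delta L x0 f,
          oracle_class sigma f mu G &
      forall (dT : measure_display) (T : measurableType dT)
             (P : probability T R) (A : run W x0 mu G K P),
        ((c2 * rate L Delta sigma n (beta W pi) (kappa pi) K)%:E
         <= 'E_P[fun w => (enorm (gradient (average f) (output A w)) ^+ 2)%R])%E]]].
Proof.
(* [128 * 300] from the relay is doubled, the rate being at most twice its larger term;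
   [1 + 2 / beta0] is lost in comparing the second term with [n / K]. *)
pose c2 : R := (256 * 300 * (1 + 2 / beta0))^-1.
have b20 : 0 < 2 / beta0 by rewrite divr_gt0.
have c20 : 0 < c2 by rewrite invr_gt0; apply: mulr_gt0; lra.
exists 2^-1, c2; split => // L Delta sigma n b L0 D0 s0 n2 b0b bn.
have b0 : 0 < b by exact: lt_le_trans b0b.
have n0 : (0 < n)%N by exact: ltnW.
have nR0 : 0 < n%:R :> R by rewrite ltr0n.
have n1b : 1 <= n%:R * (1 - b).
  by rewrite mulrC -ler_pdivrMr// mul1r; lra.
have b1 : b < 1.
  have : 0 < n%:R^-1 :> R by rewrite invr_gt0.
  by move: n%:R^-1 bn => x bn; lra.
have [W [pi [mixW eqW betaW /andP[lnl lnu] WE]]] := mixing_matrix_exists n2 b0 b1.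
exists W, pi; split => //; rewrite betaW// => K K0.
have KR0 : 0 < K%:R :> R by rewrite ltr0n.
move=> rateLD; rewrite -/(forced_gradient W L Delta sigma K _).
have [LD|LD] := leP (L * Delta) 0.
  have LDE : L * Delta = 0 by apply/eqP; rewrite eq_le LD mulr_ge0.
  apply: forced_gradient_le (forced_gradient_trivial W sigma K n0 L0 D0).
  by rewrite mulr_ge0_le0 ?(ltW c20)// (le_trans rateLD)// LDE.
have L1 : 0 < L by rewrite lt_neqAle L0 andbT eq_sym; apply/eqP => E; rewrite E mul0r ltxx in LD.
have D1 : 0 < Delta by rewrite lt_neqAle D0 andbT eq_sym; apply/eqP => E; rewrite E mulr0 ltxx in LD.
move: rateLD; rewrite /rate.
set t1 := sigma * _ / _; set l := ln _ in lnl lnu *.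
have -> : (1 + l) * L * Delta / ((1 - b) * K%:R) = L * Delta * ((1 + l) / ((1 - b) * K%:R)).
  by rewrite [RHS]mulrA [L * Delta * (1 + l)]mulrC mulrA.
set t2 := (1 + l) / _ => rateLD.
have t10 : 0 <= t1 by rewrite divr_ge0 ?sqrtr_ge0// mulr_ge0 ?sqrtr_ge0.
have b10 : 0 < 1 - b by lra.
have l0 : 0 <= l by apply: le_trans lnl; rewrite !mulr_ge0// ltW.
have t20 : 0 < t2 by rewrite divr_gt0 ?mulr_gt0//; lra.
have t21 : t2 <= 1.
  rewrite -(ler_pM2l LD) mulr1; lra.
(* The 1 in [1 + l] is absorbed by [1 <= n (1 - b)], and [l] by its upper bound, with [b >= beta0]
   in the denominator. *)
have t2n : t2 * K%:R <= n%:R * (1 + 2 / beta0).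
  have -> : t2 * K%:R = (1 + l) / (1 - b) by rewrite /t2; field; rewrite !gt_eqF.
  rewrite ler_pdivrMr//.
  have : (1 - b) / b <= (1 - b) / beta0 by rewrite ler_wpM2l ?(ltW b10)// lef_pV2.
  move: lnu; rewrite [(1 - b) / beta0]mulrC.
  move: ((1 - b) / b) beta0^-1 => x y lnu xy.
  have : 2 * n%:R * x <= 2 * n%:R * (y * (1 - b)) by rewrite ler_wpM2l// mulr_ge0// ltW.
  lra.
(* The lower bound on [l] makes [(1 + l) / (1 - b)] at least [n / 2], and [t2 <= 1] makes it at most
   [K]. *)
have nK : (n <= 2 * K)%N.
  rewrite -(ler_nat R) natrM.
  have : (1 + l) / (1 - b) <= K%:R.
    have -> : (1 + l) / (1 - b) = t2 * K%:R by rewrite /t2; field; rewrite !gt_eqF.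
    by rewrite ler_piMl// ltW.
  by rewrite ler_pdivrMr// => h; nra.
(* The larger term of the rate selects the instance. *)
have [t12|t21'] := leP (L * Delta * t2) t1.
  have t1_gt0 : 0 < t1 by apply: lt_le_trans t12; rewrite mulr_gt0.
  have a0 : 0 < Num.sqrt (L * Delta) by rewrite sqrtr_gt0.
  have c0 : 0 < Num.sqrt (n%:R * K%:R) :> R by rewrite sqrtr_gt0 mulr_gt0.
  have sg0 : 0 < sigma.
    rewrite lt_neqAle s0 andbT eq_sym; apply/eqP => E.
    by move: t1_gt0; rewrite /t1 E !mul0r ltxx.
  apply: forced_gradient_le (forced_gradient_noise W n0 K0 L1 D1 sg0 _); rewrite -/t1.
    have : c2 <= (64 * 100)^-1.
      by rewrite /c2 lef_pV2 ?posrE; lra.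
    by move=> h; nra.
  have : t1 <= L * Delta by have := mulr_gt0 LD t20; lra.
  rewrite /t1 ler_pdivrMr// -{2}(sqr_sqrtr (ltW LD)) expr2 -mulrA [_ * (_ * _)]mulrC.
  by rewrite ler_pM2r.
apply: forced_gradient_le (forced_gradient_relay sigma n2 nK L1 D1 WE).
have -> : L * Delta * n%:R / (128 * 300 * K%:R) = L * Delta * (n%:R / (128 * 300 * K%:R)).
  by rewrite mulrA.
apply: (@le_trans _ _ (c2 * (2 * (L * Delta * t2)))).
  by rewrite ler_wpM2l ?(ltW c20)//; lra.
have -> : c2 * (2 * (L * Delta * t2)) = L * Delta * (2 * c2 * t2) by ring.
rewrite ler_wpM2l ?(ltW LD)// ler_pdivlMr; last by apply: mulr_gt0 KR0; lra.
have -> : 2 * c2 * t2 * (128 * 300 * K%:R) = (t2 * K%:R) / (1 + 2 / beta0).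
  rewrite /c2; move: (2 / beta0) b20 => y y0; field.
  by rewrite gt_eqF//; lra.
by rewrite ler_pdivrMr//; lra.
Qed.
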